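(* Let $\Lambda$ be a left and right Noetherian ring which is left and right quasi Auslander-Gorenstein with $\mathrm{id}_\Lambda\Lambda=\mathrm{id}_{\Lambda^{op}}\Lambda=t$. If $M$ is a finitely generated left $\Lambda$-module with $\mathrm{grade}\,M=t$, then $M\cong\mathrm{Ext}^t_{\Lambda^{op}}(\mathrm{Ext}^t_\Lambda(M,\Lambda),\Lambda)$. Moreover, the functors $\mathrm{Ext}^t_\Lambda(\ ,\Lambda)$ and $\mathrm{Ext}^t_{\Lambda^{op}}(\ ,\Lambda)$ give a duality between $\mathcal G_t$ and $\mathcal G_t^{op}$, where $\mathcal G_t$ (resp. $\mathcal G_t^{op}$) consists of the finitely generated left (resp. right) $\Lambda$-modules of grade equal to $t$.
   Context: Let $0\to{}_\Lambda\Lambda\to I'_0\to I'_1\to\cdots$ and $0\to\Lambda_\Lambda\to I_0\to I_1\to\cdots$ be minimal injective resolutions of $\Lambda$ as a left and as a right module. $\Lambda$ is left (resp. right) quasi $\infty$-Gorenstein if the flat dimension of $I'_i$ (resp. $I_i$) is at most $i+1$ for all $i\ge0$. A left (resp. right) quasi $\infty$-Gorenstein ring is called left (resp. right) quasi Auslander-Gorenstein if it has finite left and right self-injective dimensions. $\mathrm{id}_\Lambda\Lambda$ and $\mathrm{id}_{\Lambda^{op}}\Lambda$ are the injective dimensions of $\Lambda$ as a left and as a right module. For a finitely generated (left or right) module $M$, $\mathrm{grade}\,M$ is the least $j\ge0$ with $\mathrm{Ext}^j(M,\Lambda)\ne0$ ($\infty$ if there is none). $\mathcal G_t$ and $\mathcal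 G_t^{op}$ are regarded as full subcategories of the categories of finitely generated left, respectively right, $\Lambda$-modules. *)

(* Defs.v *)
From HB Require Import structures.
From mathcomp Require Import all_boot all_order all_algebra.
From mathcomp Require Import finmap.
From mathcomp Require Import generic_quotient ring_quotient.
From mathcomp Require Import boolp.
From mathcomp.multinomials Require Import monalg.

Set Implicit Arguments.
Unset Strict Implicit.
Unset Printing Implicit Defensive.

Import GRing.Theory.
Local Open Scope ring_scope.
Local Open Scope quotient_scope.

(* Left modules over [R] are [lmodType R]; right modules over [R] are
   [lmodType R^c], i.e. left modules over the converse ring.  [pzRingType]
   also covers the zero ring. *)

Lemma linear_ext (R : pzRingType) (U V : lmodType R) (f g : {linear U -> V}) :
  f =1 g -> f = g.
Proof.
case: f g => [f [[a] [b]]] [g [[a'] [b']]] /= fg.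
have efg : f = g by apply: funext.
move: a' b' {fg}; rewrite -efg => a' b'.
by rewrite (Prop_irrelevance a a') (Prop_irrelevance b b').
Qed.

Section Kernel.
Variables (R : pzRingType) (U V : lmodType R) (f : {linear U -> V}).

Definition ker_pred : {pred U} := fun x => f x == 0.

Lemma ker_pred_submod : subsemimod_closed ker_pred.
Proof.
split; first split; first by rewrite unfold_in /ker_pred linear0.
- move=> x y; rewrite !unfold_in /ker_pred linearD => /eqP-> /eqP->.
  by rewrite addr0.
- by move=> a x; rewrite !unfold_in /ker_pred linearZ => /eqP-> /=; rewrite scaler0.
Qed.
HB.instance Definition _ := GRing.isSubmodClosed.Build R U ker_pred ker_pred_submod.

Definition kernel : Type := {x : U | ker_pred x}.
HB.instance Definition _ := SubChoice.on kernel.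
HB.instance Definition _ := [SubChoice_isSubLmodule of kernel by <:].
End Kernel.

Section ModuleQuotient.
Variables (R : pzRingType) (V : lmodType R) (I : submodClosed V).

(* The library quotient [Quotient.quot] is indexed by a [zmodClosed] predicate. *)
Definition quot_pred : {pred V} := fun x => x \in I.
Lemma quot_pred_zmod : zmod_closed quot_pred.
Proof.
split=> [|x y Ix Iy]; first exact: (rpred0 I).
by apply: (rpredD (S := I)) => //; rewrite -scaleN1r; apply: (rpredZ (s := I)).
Qed.
HB.instance Definition _ := GRing.isZmodClosed.Build V quot_pred quot_pred_zmod.

Definition lquot : Type := Quotient.quot quot_pred.
HB.instance Definition _ := GRing.Zmodule.on lquot.

Definition lproj : V -> lquot := \pi_(Quotient.quot quot_pred).

Lemma lproj_eq x y : (lproj x = lproj y) <-> (x - y \in I).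
Proof.
rewrite -[x - y \in I]/(x - y \in quot_pred) Quotient.idealrBE.
by split=> /eqP.
Qed.

Lemma lproj_surj q : exists x, q = lproj x.
Proof. by exists (repr q); rewrite /lproj reprK. Qed.

Lemma lprojB x y : lproj (x - y) = lproj x - lproj y.
Proof. exact: (raddfB (\pi_(Quotient.quot quot_pred))). Qed.

Lemma lprojD x y : lproj (x + y) = lproj x + lproj y.
Proof. exact: (raddfD (\pi_(Quotient.quot quot_pred))). Qed.

Definition lquot_scale (a : R) (q : lquot) : lquot := lproj (a *: repr q).

Lemma lprojZ a x : lquot_scale a (lproj x) = lproj (a *: x).
Proof.
apply/lproj_eq; rewrite -scalerBr; apply: rpredZ.
by apply/lproj_eq; rewrite /lproj reprK.
Qed.

Lemma lquot_scaleA a b q : lquot_scale a (lquot_scale b q) = lquot_scale (a * b) q.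
Proof. by have [x ->] := lproj_surj q; rewrite !lprojZ scalerA. Qed.
Lemma lquot_scale1 : left_id 1 lquot_scale.
Proof. by move=> q; have [x ->] := lproj_surj q; rewrite lprojZ scale1r. Qed.
Lemma lquot_scaleDr : right_distributive lquot_scale +%R.
Proof.
move=> a q q'; have [x ->] := lproj_surj q; have [y ->] := lproj_surj q'.
by rewrite -lprojD !lprojZ scalerDr lprojD.
Qed.
Lemma lquot_scaleDl q : {morph lquot_scale^~ q : a b / a + b}.
Proof.
by move=> a b; have [x ->] := lproj_surj q; rewrite !lprojZ scalerDl lprojD.
Qed.
HB.instance Definition _ := GRing.Zmodule_isLmodule.Build R lquot
  lquot_scaleA lquot_scale1 lquot_scaleDr lquot_scaleDl.

Lemma lproj_linear : linear lproj.
Proof. by move=> a x y; rewrite lprojD -[a *: lproj x]/(lquot_scale _ _) lprojZ. Qed.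
HB.instance Definition _ := GRing.isLinear.Build R V lquot _ lproj lproj_linear.

End ModuleQuotient.

Section QuotientMap.
Variables (R : pzRingType) (V V' : lmodType R).
Variables (I : submodClosed V) (I' : submodClosed V') (h : {linear V -> V'}).

(* [hI] is what makes the value independent of the representative. *)
Definition lquot_map (hI : forall x, x \in I -> h x \in I') (q : lquot I) :
  lquot I' := lproj I' (h (repr q)).

Variable hI : forall x, x \in I -> h x \in I'.

Lemma lquot_mapE x : lquot_map hI (lproj I x) = lproj I' (h x).
Proof.
by apply/lproj_eq; rewrite -linearB; apply/hI/lproj_eq; rewrite /lproj reprK.
Qed.

Lemma lquot_map_linear : linear (lquot_map hI).
Proof.
move=> a q q'; have [x ->] := lproj_surj q; have [y ->] := lproj_surj q'.
by rewrite -linearP !lquot_mapE !linearP.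
Qed.
HB.instance Definition _ := GRing.isLinear.Build R (lquot I) (lquot I') _
  (lquot_map hI) lquot_map_linear.

End QuotientMap.

Section Span.
Variables (R : pzRingType) (V : lmodType R) (S : V -> Prop).

Definition gen_pred : {pred V} :=
  fun x => `[< forall W : submodClosed V, (forall s, S s -> s \in W) -> x \in W >].

Lemma gen_predP x : reflect
  (forall W : submodClosed V, (forall s, S s -> s \in W) -> x \in W)
  (x \in gen_pred).
Proof. exact: asboolP. Qed.

Lemma gen_pred_submod : subsemimod_closed gen_pred.
Proof.
split; first split.
- by apply/gen_predP => W _; apply: rpred0.
- move=> x y /gen_predP Hx /gen_predP Hy; apply/gen_predP => W SW.
  by apply: rpredD; [apply: Hx | apply: Hy].
- move=> a x /gen_predP Hx; apply/gen_predP => W SW.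
  by apply: rpredZ; apply: Hx.
Qed.
HB.instance Definition _ := GRing.isSubmodClosed.Build R V gen_pred gen_pred_submod.
End Span.

(* The homology [ker g / im f] at [V] of [U --f--> V --g--> W]. *)
Section Homology.
Variables (R : pzRingType) (U V W : lmodType R).
Variables (f : {linear U -> V}) (g : {linear V -> W}).

Definition bnd_pred : {pred kernel g} := fun z => `[< exists u, f u = val z >].

Lemma bnd_predP z : reflect (exists u, f u = val z) (z \in bnd_pred).
Proof. exact: asboolP. Qed.

Lemma bnd_pred_submod : subsemimod_closed bnd_pred.
Proof.
split; first split.
- by apply/bnd_predP; exists 0; rewrite !linear0.
- move=> x y /bnd_predP[u Hu] /bnd_predP[v Hv]; apply/bnd_predP.
  by exists (u + v); rewrite !linearD /= Hu Hv.
- move=> a x /bnd_predP[u Hu]; apply/bnd_predP.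
  by exists (a *: u); rewrite !linearZ /= Hu.
Qed.
HB.instance Definition _ :=
  GRing.isSubmodClosed.Build R (kernel g) bnd_pred bnd_pred_submod.

Definition homology : lmodType R := lquot bnd_pred.
End Homology.
Arguments bnd_pred {R U V W} f g.

Section Free.
Variables (R : pzRingType) (X : choiceType).

(* [malg] is a module in the library only for non-trivial rings. *)
Definition free : Type := {malg R[X]}.
HB.instance Definition _ := GRing.Zmodule.on free.

Definition free_scale (a : R) (g : free) : free :=
  [malg k in msupp g => a * g@_k].

Lemma free_scaleE a g k : (free_scale a g)@_k = a * g@_k.
Proof. by rewrite mcoeffE; case: msuppP; rewrite ?mulr0. Qed.
Lemma free_scaleA a b g : free_scale a (free_scale b g) = free_scale (a * b) g.
Proof. by apply/malgP => k; rewrite !free_scaleE mulrA. Qed.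
Lemma free_scale1 : left_id 1 free_scale.
Proof. by move=> g; apply/malgP => k; rewrite free_scaleE mul1r. Qed.
Lemma free_scaleDr : right_distributive free_scale +%R.
Proof. by move=> a g h; apply/malgP => k; rewrite !(mcoeffD, free_scaleE) mulrDr. Qed.
Lemma free_scaleDl g : {morph free_scale^~ g : a b / a + b}.
Proof. by move=> a b; apply/malgP => k; rewrite !(mcoeffD, free_scaleE) mulrDl. Qed.
HB.instance Definition _ := GRing.Zmodule_isLmodule.Build R free
  free_scaleA free_scale1 free_scaleDr free_scaleDl.

Definition free_gen (x : X) : free := << x >>.

Section Lift.
Variables (V : lmodType R) (h : X -> V).

Definition free_lift (g : free) : V := \sum_(k <- msupp g) g@_k *: h k.

Lemma free_liftEw (D : {fset X}) g : (msupp g `<=` D)%fset ->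
  free_lift g = \sum_(k <- D) g@_k *: h k.
Proof.
move=> le_gD; rewrite /free_lift (big_fset_incl _ le_gD) // => k _.
by move=> /mcoeff_outdom ->; rewrite scale0r.
Qed.

Lemma free_lift_linear : linear free_lift.
Proof.
move=> a g1 g2; pose D := (msupp (a *: g1 + g2) `|` (msupp g1 `|` msupp g2))%fset.
rewrite (@free_liftEw D) ?fsubsetUl // (@free_liftEw D g1); last first.
  by apply: fsubset_trans (fsubsetUr _ _); apply: fsubsetUl.
rewrite (@free_liftEw D g2); last first.
  by apply: fsubset_trans (fsubsetUr _ _); apply: fsubsetUr.
rewrite scaler_sumr -big_split /=; apply: eq_bigr => k _.
by rewrite mcoeffD free_scaleE scalerDl scalerA.
Qed.
HB.instance Definition _ := GRing.isLinear.Build R free V _ free_lift free_lift_linear.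

Lemma free_lift_gen x : free_lift (free_gen x) = h x.
Proof.
rewrite (@free_liftEw [fset x]%fset) ?msuppU_le // big_seq_fset1.
by rewrite mcoeffUU scale1r.
Qed.

Lemma free_gen_sum (g : free) : g = \sum_(k <- msupp g) g@_k *: free_gen k.
Proof.
rewrite {1}[g]monalgE; apply: eq_bigr => k _.
by apply/malgP => k'; rewrite free_scaleE !mcoeffU mulrnAr mulr1.
Qed.

Lemma free_lift_unique (f : {linear free -> V}) :
  (forall x, f (free_gen x) = h x) -> f =1 free_lift.
Proof.
move=> fh g; rewrite {1}[g]free_gen_sum linear_sum; apply: eq_bigr => k _.
by rewrite linearZ /= fh.
Qed.

End Lift.
End Free.

Section FreeMap.
Variables (R : pzRingType) (X Y : choiceType) (h : X -> Y).
Definition free_map : {linear free R X -> free R Y} :=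
  free_lift (fun x => free_gen R (h x)).
Lemma free_map_gen x : free_map (free_gen R x) = free_gen R (h x).
Proof. exact: free_lift_gen. Qed.
End FreeMap.

Lemma free_eq (R : pzRingType) (X : choiceType) (V : lmodType R)
  (f g : {linear free R X -> V}) :
  (forall x, f (free_gen R x) = g (free_gen R x)) -> f =1 g.
Proof.
move=> fg x; rewrite (@free_lift_unique _ _ _ (fun x => g (free_gen R x)) f) //.
by rewrite -(@free_lift_unique _ _ _ (fun x => g (free_gen R x)) g).
Qed.

Section TensorProduct.
Variables (R : pzRingType) (A : lmodType R^c) (F : lmodType R).

Local Notation Z := (free int (A * F)%type).
Local Notation tns a x := (free_gen int (a, x) : Z).

Inductive tensor_rel : Z -> Prop :=
| tensor_addl a b x : tensor_rel (tns (a + b) x - tns a x - tns b x)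
| tensor_addr a x y : tensor_rel (tns a (x + y) - tns a x - tns a y)
| tensor_balanced (r : R) a x :
    tensor_rel (tns ((r : R^c) *: a) x - tns a (r *: x)).

Definition tensor : lmodType int := lquot (gen_pred tensor_rel).
End TensorProduct.
Section TensorMap.
Variables (R : pzRingType) (A B : lmodType R^c) (F : lmodType R).
Variable f : {linear A -> B}.
Let f1 (p : A * F) : B * F := (f p.1, p.2).

Lemma tensor_map_subproof x : x \in gen_pred (@tensor_rel R A F) ->
  free_map int f1 x \in gen_pred (@tensor_rel R B F).
Proof.
move=> /gen_predP Hx; apply/gen_predP => W relW.
pose W' : {pred free int (A * F)%type} := fun x => free_map int f1 x \in W.
have W'sub : subsemimod_closed W'.
  split; first split.
  - by rewrite unfold_in /W' linear0 rpred0.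
  - by move=> y z; rewrite !unfold_in /W' linearD; apply: (rpredD (S := W)).
  - by move=> a y; rewrite !unfold_in /W' linearZ; apply: (rpredZ (s := W)).
pose W'm := GRing.isSubmodClosed.Build _ _ W' W'sub.
pose W'p : submodClosed _ := HB.pack W' W'm.
apply: (Hx W'p) => _ [a b y|a y z|r a y]; rewrite unfold_in /= /W' !linearB /=;
  rewrite !free_map_gen /f1 /= ?linearD ?linearZ; apply: relW;
  [exact: tensor_addl|exact: tensor_addr|exact: tensor_balanced].
Qed.

Definition tensor_map : {linear tensor A F -> tensor B F} :=
  lquot_map tensor_map_subproof.

Lemma tensor_map_pure a x :
  tensor_map (lproj _ (free_gen int (a, x))) = lproj _ (free_gen int (f a, x)).
Proof. by rewrite [LHS]lquot_mapE free_map_gen. Qed.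
End TensorMap.

Definition fin_gen_sub (R : pzRingType) (V : lmodType R) (I : {pred V}) : Prop :=
  exists (n : nat) (e : 'I_n -> V), (forall i, e i \in I) /\
    forall x, x \in I -> exists c : 'I_n -> R, x = \sum_i c i *: e i.

Definition fin_gen (R : pzRingType) (M : lmodType R) : Prop :=
  fin_gen_sub (predT : {pred M}).

(* left Noetherian; [noetherian R^c] is right Noetherian *)
Definition noetherian (R : pzRingType) : Prop :=
  forall I : submodClosed R^o, fin_gen_sub (I : {pred R^o}).

Definition exact_at (R : pzRingType) (U V W : lmodType R)
    (f : {linear U -> V}) (g : {linear V -> W}) : Prop :=
  forall y, g y = 0 <-> exists x, f x = y.

Definition surj (T U : Type) (f : T -> U) : Prop := forall y, exists x, f x = y.

Definition trivial_mod (R : pzRingType) (V : lmodType R) : Prop :=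
  forall x : V, x = 0.

Definition injective_mod (R : pzRingType) (E : lmodType R) : Prop :=
  forall (A B : lmodType R) (i : {linear A -> B}) (f : {linear A -> E}),
    injective i -> exists g : {linear B -> E}, forall x, g (i x) = f x.

Definition flat_mod (R : pzRingType) (F : lmodType R) : Prop :=
  forall (A B : lmodType R^c) (f : {linear A -> B}),
    injective f -> injective (tensor_map F f).

Record injective_resolution (R : pzRingType) (M : lmodType R) :=
  InjectiveResolution {
    ir_obj :> nat -> lmodType R;
    ir_aug : {linear M -> ir_obj 0};
    ir_d : forall i, {linear ir_obj i -> ir_obj i.+1};
    ir_injective : forall i, injective_mod (ir_obj i);
    ir_aug_inj : injective ir_aug;
    ir_exact0 : exact_at ir_aug (ir_d 0);
    ir_exact : forall i, exact_at (ir_d i) (ir_d i.+1) }.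

Definition has_essential_image (R : pzRingType) (U V : lmodType R)
    (f : {linear U -> V}) : Prop :=
  forall W : submodClosed V,
    (forall u, f u \in W -> f u = 0) -> forall x, x \in W -> x = 0.

(* Each term is an injective hull of the image of the preceding map. *)
Definition minimal_resolution (R : pzRingType) (M : lmodType R)
    (I : injective_resolution M) : Prop :=
  has_essential_image (ir_aug I) /\ forall i, has_essential_image (ir_d I i).

Record flat_resolution (R : pzRingType) (M : lmodType R) := FlatResolution {
  fr_obj :> nat -> lmodType R;
  fr_aug : {linear fr_obj 0 -> M};
  fr_d : forall i, {linear fr_obj i.+1 -> fr_obj i};
  fr_flat : forall i, flat_mod (fr_obj i);
  fr_aug_surj : surj fr_aug;
  fr_exact0 : exact_at (fr_d 0) fr_aug;
  fr_exact : forall i, exact_at (fr_d i.+1) (fr_d i) }.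

Definition injdim_le (R : pzRingType) (M : lmodType R) (n : nat) : Prop :=
  exists I : injective_resolution M, forall i, (n < i)%N -> trivial_mod (I i).

Definition injdim_eq (R : pzRingType) (M : lmodType R) (n : nat) : Prop :=
  injdim_le M n /\ forall m, injdim_le M m -> (n <= m)%N.

Definition flatdim_le (R : pzRingType) (M : lmodType R) (n : nat) : Prop :=
  exists P : flat_resolution M, forall i, (n < i)%N -> trivial_mod (P i).

Definition left_quasi_inf_Gorenstein (R : pzRingType) : Prop :=
  exists2 I : injective_resolution R^o,
    minimal_resolution I & forall i, flatdim_le (I i) i.+1.

Definition right_quasi_inf_Gorenstein (R : pzRingType) : Prop :=
  left_quasi_inf_Gorenstein R^c.

Definition finite_self_injdim (R : pzRingType) : Prop :=
  exists n, injdim_le R^o n.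

Definition left_quasi_AG (R : pzRingType) : Prop :=
  [/\ left_quasi_inf_Gorenstein R, finite_self_injdim R
    & finite_self_injdim R^c].

Definition right_quasi_AG (R : pzRingType) : Prop :=
  [/\ right_quasi_inf_Gorenstein R, finite_self_injdim R
    & finite_self_injdim R^c].

(* [Hom_R(M, R)] as an [S]-module, where [phi : S -> R^c] lets [S] act on [R]
   from the right: [(s *: f) x = f x * phi s].  The two cases of interest are
   [S = R^c], [phi = id], and, for the ring [R^c], [S = R],
   [phi = id : R -> R^c^c].  (The rings [R] and [R^c^c] are equal only up to
   their proof components, hence the parameter.) *)
Definition dual (R S : pzRingType) (phi : {rmorphism S -> R^c}) (M : lmodType R)
  : Type := {linear M -> R^o}.

Section Dual.
Variables (R S : pzRingType) (phi : {rmorphism S -> R^c}).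
Local Notation dual := (dual phi).

Section DualModule.
Variable M : lmodType R.
HB.instance Definition _ := gen_eqMixin (dual M).
HB.instance Definition _ := gen_choiceMixin (dual M).

Implicit Types f g h : dual M.

Definition dual_fun (F : M -> R^o) (linF : linear F) : dual M :=
  HB.pack F (GRing.isLinear.Build R M R^o *:%R F linF).

Lemma dual0_subproof : linear (fun _ : M => 0 : R^o).
Proof. by move=> a x y; rewrite scaler0 addr0. Qed.
Lemma dualD_subproof f g : linear (fun x => f x + g x).
Proof. by move=> a x y; rewrite !linearP addrACA scalerDr. Qed.
Lemma dualN_subproof f : linear (fun x => - f x).
Proof. by move=> a x y; rewrite linearP opprD scalerN. Qed.
Lemma dualZ_subproof (s : S) f : linear (fun x => (f x : R) * (phi s : R) : R^o).
Proof. by move=> a x y; rewrite linearP mulrDl -mulrA. Qed.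

Definition dual0 : dual M := dual_fun dual0_subproof.
Definition dualD f g : dual M := dual_fun (dualD_subproof f g).
Definition dualN f : dual M := dual_fun (dualN_subproof f).
Definition dualZ s f : dual M := dual_fun (dualZ_subproof s f).

Lemma dualDA : associative dualD.
Proof. by move=> f g h; apply: linear_ext => x /=; rewrite addrA. Qed.
Lemma dualDC : commutative dualD.
Proof. by move=> f g; apply: linear_ext => x /=; rewrite addrC. Qed.
Lemma dual0D : left_id dual0 dualD.
Proof. by move=> f; apply: linear_ext => x /=; rewrite add0r. Qed.
Lemma dualND : left_inverse dual0 dualN dualD.
Proof. by move=> f; apply: linear_ext => x /=; rewrite addNr. Qed.
HB.instance Definition _ :=
  GRing.isZmodule.Build (dual M) dualDA dualDC dual0D dualND.

Lemma dualZA a b f : dualZ a (dualZ b f) = dualZ (a * b) f.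
Proof. by apply: linear_ext => x /=; rewrite rmorphM -mulrA. Qed.
Lemma dualZ1 : left_id 1 dualZ.
Proof. by move=> f; apply: linear_ext => x /=; rewrite rmorph1 mulr1. Qed.
Lemma dualZDr : right_distributive dualZ +%R.
Proof. by move=> a f g; apply: linear_ext => x /=; rewrite mulrDl. Qed.
Lemma dualZDl f : {morph dualZ^~ f : a b / a + b}.
Proof. by move=> a b; apply: linear_ext => x /=; rewrite rmorphD mulrDr. Qed.
HB.instance Definition _ :=
  GRing.Zmodule_isLmodule.Build S (dual M) dualZA dualZ1 dualZDr dualZDl.

End DualModule.

Section DualMap.
Variables (M N : lmodType R) (h : {linear M -> N}).

Definition dual_map (f : dual N) : dual M := (f : {linear N -> R^o}) \o h.

Lemma dual_map_linear : linear dual_map.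
Proof. by move=> a f g; apply: linear_ext => x. Qed.
HB.instance Definition _ :=
  GRing.isLinear.Build S (dual N) (dual M) _ dual_map dual_map_linear.
End DualMap.
End Dual.
Arguments dual_map {R S} phi {M N} h f.

(* [Ext] is computed from the functorial free resolution
     ... -> free (syz 1 M) -> free (syz 0 M) -> M -> 0,
   with [syz 0 M = M] and [syz n.+1 M] the kernel of the canonical map
   [free (syz n M) -> syz n M]. *)
Section FreeResolution.
Variable R : pzRingType.

Section Obj.
Variable M : lmodType R.
Definition aug : {linear free R M -> M} := free_lift id.
Definition syz1 : lmodType R := kernel aug.
Definition syz1_val : {linear syz1 -> free R M} := (val : kernel aug -> _).
Lemma syz1P (x : syz1) : aug (syz1_val x) = 0.
Proof. by apply/eqP; case: x. Qed.
End Obj.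
Arguments syz1_val {M}.

Fixpoint syz (n : nat) (M : lmodType R) : lmodType R :=
  if n is n'.+1 then syz1 (syz n' M) else M.

Definition res (n : nat) (M : lmodType R) : lmodType R := free R (syz n M).

Definition resd (n : nat) (M : lmodType R) : {linear res n.+1 M -> res n M} :=
  @syz1_val (syz n M) \o aug (syz n.+1 M).

Section Map1.
Variables (M N : lmodType R) (f : {linear M -> N}).

Lemma aug_nat x : aug N (free_map R f x) = f (aug M x).
Proof.
move: x; apply: (@free_eq _ _ _ (aug N \o free_map R f) (f \o aug M)) => x /=.
by rewrite free_map_gen !free_lift_gen.
Qed.

Lemma syz1_map_subproof (x : syz1 M) :
  ker_pred (aug N) (free_map R f (syz1_val x)).
Proof. by rewrite /ker_pred aug_nat syz1P linear0. Qed.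

Definition syz1_map_fun (x : syz1 M) : syz1 N :=
  Sub (free_map R f (syz1_val x)) (syz1_map_subproof x).

Lemma syz1_map_linear : linear syz1_map_fun.
Proof. by move=> a x y; apply: val_inj; rewrite /= !linearP. Qed.
HB.instance Definition _ :=
  GRing.isLinear.Build R (syz1 M) (syz1 N) _ syz1_map_fun syz1_map_linear.
Definition syz1_map : {linear syz1 M -> syz1 N} := syz1_map_fun.

Lemma syz1_map_val x : syz1_val (syz1_map x) = free_map R f (syz1_val x).
Proof. by []. Qed.
End Map1.

Section Map.
Variables (M N : lmodType R) (f : {linear M -> N}).

Fixpoint syz_map (n : nat) : {linear syz n M -> syz n N} :=
  if n is n'.+1 then syz1_map (syz_map n') else f.

Definition res_map (n : nat) : {linear res n M -> res n N} :=
  free_map R (syz_map n).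

Lemma res_map_nat n x : resd n N (res_map n.+1 x) = res_map n (resd n M x).
Proof. by rewrite /= aug_nat. Qed.
End Map.

Lemma free_map_id (X : choiceType) (h : X -> X) : h =1 id ->
  free_map R h =1 id.
Proof.
move=> hid; apply: (@free_eq _ _ _ (free_map R h) idfun) => x.
by rewrite free_map_gen hid.
Qed.

Lemma free_map_comp (X Y Z : choiceType) (h : X -> Y) (k : Y -> Z) (l : X -> Z) :
  l =1 k \o h -> free_map R l =1 free_map R k \o free_map R h.
Proof.
move=> lkh; apply: (@free_eq _ _ _ (free_map R l) (free_map R k \o free_map R h)).
by move=> x /=; rewrite !free_map_gen lkh.
Qed.

Lemma syz_map_id (M : lmodType R) n : syz_map (@idfun M) n =1 id.
Proof.
elim: n => [|n IHn] //= x; apply: val_inj => /=.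
by rewrite (free_map_id IHn).
Qed.

Lemma syz_map_comp (L M N : lmodType R) (f : {linear L -> M}) (g : {linear M -> N}) n :
  syz_map (g \o f) n =1 syz_map g n \o syz_map f n.
Proof.
elim: n => [|n IHn] //= x; apply: val_inj => /=.
by rewrite (free_map_comp IHn).
Qed.

(* [res] is a resolution of [M] by free modules. *)
Lemma aug_surj M : surj (aug M).
Proof. by move=> x; exists (free_gen R x); exact: free_lift_gen. Qed.

Lemma res_exact0 M : exact_at (resd 0 M) (aug M).
Proof.
move=> y; split=> [y0|[x <-]]; last exact: syz1P.
have /eqP yk := y0; have [x Hx] := aug_surj (Sub y yk : syz1 M).
by exists x; rewrite /= Hx.
Qed.

Lemma res_exact n M : exact_at (resd n.+1 M) (resd n M).
Proof.
move=> y; apply: iff_trans (@res_exact0 (syz n.+1 M) y).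
split=> H; first by apply: val_inj; exact: H.
by rewrite /= H; exact: (linear0 syz1_val).
Qed.

End FreeResolution.

Section HomologyMap.
Variables (R : pzRingType) (U V W U' V' W' : lmodType R).
Variables (f : {linear U -> V}) (g : {linear V -> W}).
Variables (f' : {linear U' -> V'}) (g' : {linear V' -> W'}).
Variables (u : {linear U -> U'}) (v : {linear V -> V'}) (w : {linear W -> W'}).
Hypothesis vf : forall x, v (f x) = f' (u x).
Hypothesis wg : forall x, w (g x) = g' (v x).

Lemma ker_map_subproof (z : kernel g) : ker_pred g' (v (val z)).
Proof.
by case: z => z /= /eqP z0; rewrite /ker_pred -wg z0 linear0.
Qed.

Definition ker_map (z : kernel g) : kernel g' := Sub (v (val z)) (ker_map_subproof z).

Lemma ker_map_linear : linear ker_map.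
Proof. by move=> a x y; apply: val_inj; rewrite /= !linearP. Qed.
HB.instance Definition _ :=
  GRing.isLinear.Build R (kernel g) (kernel g') _ ker_map ker_map_linear.

Lemma homology_map_subproof z : z \in bnd_pred f g -> ker_map z \in bnd_pred f' g'.
Proof.
by move=> /bnd_predP[x Hx]; apply/bnd_predP; exists (u x); rewrite /= -Hx vf.
Qed.

Definition homology_map : {linear homology f g -> homology f' g'} :=
  lquot_map homology_map_subproof.

End HomologyMap.

(* Contravariant functor from [R]-modules to [S]-modules. *)
Record cofunctor (R S : pzRingType) := Cofunctor {
  cobj :> lmodType R -> lmodType S;
  comap : forall M N : lmodType R, {linear M -> N} -> {linear cobj N -> cobj M};
  comap_id : forall (M : lmodType R) x, comap (@idfun M) x = x;
  comap_comp : forall (L M N : lmodType R) (f : {linear L -> M}) (g : {linear M -> N}) x,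
    comap (g \o f) x = comap f (comap g x) }.

Section Ext.
Variables (R S : pzRingType) (phi : {rmorphism S -> R^c}).

Section Obj.
Variable M : lmodType R.

(* The complex [0 -> dual (res 0 M) -> dual (res 1 M) -> ...]; the map into the
   term of degree 0 is the zero map. *)
Definition Ext_out (n : nat) :
    {linear dual phi (res n M) -> dual phi (res n.+1 M)} :=
  dual_map phi (resd n M).

Definition Ext_in (n : nat) :
    {linear dual phi (res n.-1 M) -> dual phi (res n M)} :=
  if n is n'.+1 then Ext_out n' else \0.

(* [Ext^n_R(M, R)] as an [S]-module *)
Definition Ext_obj (n : nat) : lmodType S := homology (Ext_in n) (Ext_out n).
End Obj.

Section Map.
Variables (M N : lmodType R) (f : {linear M -> N}).

Definition Ext_cochain (n : nat) : {linear dual phi (res n N) -> dual phi (res n M)} :=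
  dual_map phi (res_map f n).

Lemma Ext_cochain_out n x :
  Ext_cochain n.+1 (Ext_out N n x) = Ext_out M n (Ext_cochain n x).
Proof.
by apply: linear_ext => y; rewrite /= -(@res_map_nat _ _ _ f n y).
Qed.

Lemma Ext_cochain_in n x :
  Ext_cochain n (Ext_in N n x) = Ext_in M n (Ext_cochain n.-1 x).
Proof.
by case: n x => [|n] x; [rewrite /= linear0|apply: Ext_cochain_out].
Qed.

Definition Ext_map (n : nat) : {linear Ext_obj N n -> Ext_obj M n} :=
  homology_map (@Ext_cochain_in n) (@Ext_cochain_out n).

Lemma Ext_mapE n z :
  Ext_map n (lproj _ z) = lproj _ (ker_map (@Ext_cochain_out n) z).
Proof. exact: lquot_mapE. Qed.
End Map.

Lemma Ext_map_id n (M : lmodType R) x : Ext_map (@idfun M) n x = x.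
Proof.
have [z ->] := lproj_surj x; rewrite Ext_mapE; congr lproj.
apply: val_inj; apply: linear_ext => y /=.
by congr (_ _); apply: free_map_id; apply: syz_map_id.
Qed.

Lemma Ext_map_comp n (L M N : lmodType R) (f : {linear L -> M})
    (g : {linear M -> N}) x :
  Ext_map (g \o f) n x = Ext_map f n (Ext_map g n x).
Proof.
have [z ->] := lproj_surj x; rewrite !Ext_mapE; congr lproj.
apply: val_inj; apply: linear_ext => y /=.
by congr (_ _); apply: free_map_comp; apply: syz_map_comp.
Qed.

Definition Ext (n : nat) : cofunctor R S :=
  {| comap_id := @Ext_map_id n; comap_comp := @Ext_map_comp n |}.

Definition grade_eq (M : lmodType R) (t : nat) : Prop :=
  ~ trivial_mod (Ext t M) /\ forall j, (j < t)%N -> trivial_mod (Ext j M).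

End Ext.

Section ExtLambda.
Variable R : pzRingType.

Definition to_conv2 (r : R) : R^c^c := r.
Lemma to_conv2_is_additive : zmod_morphism to_conv2.
Proof. by []. Qed.
Lemma to_conv2_is_monoid : monoid_morphism to_conv2.
Proof. by []. Qed.
HB.instance Definition _ :=
  GRing.isZmodMorphism.Build R R^c^c to_conv2 to_conv2_is_additive.
HB.instance Definition _ :=
  GRing.isMonoidMorphism.Build R R^c^c to_conv2 to_conv2_is_monoid.

(* [Ext^n(-, R)] on left modules, with values in right modules *)
Definition Ext_left (n : nat) : cofunctor R R^c := Ext (@idfun R^c) n.
(* [Ext^n(-, R)] on right modules, with values in left modules *)
Definition Ext_right (n : nat) : cofunctor R^c R := Ext to_conv2 n.

Definition left_grade_eq (M : lmodType R) (t : nat) : Prop :=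
  grade_eq (@idfun R^c) M t.
Definition right_grade_eq (N : lmodType R^c) (t : nat) : Prop :=
  grade_eq to_conv2 N t.

Definition G_left (t : nat) (M : lmodType R) : Prop :=
  fin_gen M /\ left_grade_eq M t.
Definition G_right (t : nat) (N : lmodType R^c) : Prop :=
  fin_gen N /\ right_grade_eq N t.

End ExtLambda.

Definition lmod_iso (R : pzRingType) (M N : lmodType R) : Prop :=
  exists f : {linear M -> N}, bijective f.

(* [G \o F] restricts to a functor naturally isomorphic to the identity of the
   full subcategory [C] *)
Definition nat_iso_id (R S : pzRingType) (C : lmodType R -> Prop)
    (F : cofunctor R S) (G : cofunctor S R) : Prop :=
  exists eta : forall M, C M -> {linear M -> G (F M)},
    (forall M (CM : C M), bijective (eta M CM)) /\
    forall M N (CM : C M) (CN : C N) (f : {linear M -> N}) x,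
      eta N CN (f x) = comap G (comap F f) (eta M CM x).

(* [F] and [G] restrict to mutually quasi-inverse contravariant equivalences
   between the full subcategories [C] and [D]. *)
Definition duality (R S : pzRingType)
    (C : lmodType R -> Prop) (D : lmodType S -> Prop)
    (F : cofunctor R S) (G : cofunctor S R) : Prop :=
  [/\ forall M, C M -> D (F M), forall N, D N -> C (G N),
      nat_iso_id C F G & nat_iso_id D G F].

(* Main.v *)
(* Write D for Hom(-, L).  Let M have grade t, N = Ext^t(M, L), and F -> M and Q -> N
   be free resolutions.  Since Ext^j(M, L) = 0 for j < t, the sequence
     0 -> D F_0 -> ... -> D F_(t-1) -> Z^t(D F) -> N -> 0
   is exact, so the identity of N lifts, uniquely up to homotopy, to a chain map
   h_i : Q_i -> D F_(t-i).  Reading h_t as a pairing Q_t x F_0 -> L gives the natural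
   map M -> Ext^t(N, L).
   To see that it is bijective, replace F by a resolution P by finitely generated
   projectives.  As Ext^j(M, L) = 0 also for j > t, the cone of Q -> D P is an exact
   complex of projectives, unbounded to the right; because L has finite injective
   dimension on the other side, the dual of the cone is exact again.  Finitely
   generated projectives are reflexive, so this dual compares P with D Q: it says
   that Ext^j(N, L) = 0 for j < t and that M -> Ext^t(N, L) is an isomorphism. *)

Require Import Defs.
From HB Require Import structures.
From mathcomp Require Import all_boot all_order all_algebra.
From mathcomp Require Import boolp.
Import Defs.
Set Implicit Arguments.
Unset Strict Implicit.
Unset Printing Implicit Defensive.
Import GRing.Theory.
Local Open Scope ring_scope.

(** * Factoring, lifting and extending linear maps *)

Definition lin_of (R : pzRingType) (U V : lmodType R) (F : U -> V)
    (linF : linear F) : {linear U -> V} :=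
  HB.pack F (GRing.isLinear.Build R U V *:%R F linF).

Section Lifting.
Variable R : pzRingType.

Lemma factor_surj (A B C : lmodType R) (p : {linear A -> B}) (f : {linear A -> C}) :
  surj p -> (forall x, p x = 0 -> f x = 0) ->
  exists h : {linear B -> C}, forall x, h (p x) = f x.
Proof.
move=> p_surj pf; pose r y := projT1 (cid (p_surj y)).
have rK y : p (r y) = y by rewrite /r; case: cid.
have fE x y : p x = p y -> f x = f y.
  by move=> pxy; apply/eqP; rewrite -subr_eq0 -linearB pf // linearB pxy subrr.
have linF : linear (f \o r).
  by move=> a x y; rewrite /= -linearP; apply: fE; rewrite linearP !rK.
by exists (lin_of linF) => x /=; apply: fE.
Qed.

Lemma factor_inj (A B C : lmodType R) (i : {linear A -> B}) (f : {linear C -> B}) :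
  injective i -> (forall x, exists a, i a = f x) ->
  exists h : {linear C -> A}, forall x, i (h x) = f x.
Proof.
move=> i_inj im; pose h x := projT1 (cid (im x)).
have hK x : i (h x) = f x by rewrite /h; case: cid.
have linF : linear h by move=> a x y; apply: i_inj; rewrite linearP !hK linearP.
by exists (lin_of linF).
Qed.

Lemma corestrict_ex (A B C : lmodType R) (f : {linear A -> B})
    (g : {linear B -> C}) : (forall x, g (f x) = 0) ->
  exists h : {linear A -> kernel g}, forall x, val (h x) = f x.
Proof.
move=> gf; pose h x : kernel g := Sub (f x) (introT eqP (gf x)).
have lin : linear h by move=> a x y; apply: val_inj; rewrite /= !linearP.
by exists (lin_of lin).
Qed.

Definition ker_val (A B : lmodType R) (f : {linear A -> B}) :
  {linear kernel f -> A} := (val : kernel f -> A).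

Lemma ker_valP (A B : lmodType R) (f : {linear A -> B}) x : f (ker_val f x) = 0.
Proof. by apply/eqP; case: x. Qed.

(** The map [f] need not be injective: [f] and [h] both descend to the quotient by the kernel of
    [f], where [f] becomes injective. *)
Lemma injectivity_factor (A B E : lmodType R) (f : {linear A -> B})
    (h : {linear A -> E}) : injective_mod E -> (forall x, f x = 0 -> h x = 0) ->
  exists k : {linear B -> E}, forall x, k (f x) = h x.
Proof.
move=> E_inj fh.
have lproj0 x : lproj (@ker_pred R A B f) x = 0 -> f x = 0.
  by rewrite -(linear0 (lproj _)) => /lproj_eq; rewrite subr0 => /eqP.
have lproj_s : surj (lproj (@ker_pred R A B f)).
  by move=> q; have [x ->] := lproj_surj q; exists x.
have [fq fqE] := @factor_surj _ _ _ (lproj (@ker_pred R A B f)) f lproj_s lproj0.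
have [hq hqE] := @factor_surj _ _ _ (lproj (@ker_pred R A B f)) h lproj_s
  (fun x x0 => fh x (lproj0 x x0)).
have fq_inj : injective fq.
  move=> q q'; have [x ->] := lproj_surj q; have [y ->] := lproj_surj q'.
  rewrite !fqE => fxy; apply/lproj_eq; apply/eqP.
  by rewrite linearB fxy subrr.
have [k kE] := E_inj _ _ fq hq fq_inj.
by exists k => x; rewrite -fqE kE hqE.
Qed.

Definition projective_mod (P : lmodType R) : Prop :=
  forall (A B : lmodType R) (f : {linear A -> B}) (h : {linear P -> B}),
    (forall x, exists a, f a = h x) ->
    exists k : {linear P -> A}, forall x, f (k x) = h x.

Lemma free_projective (X : choiceType) : projective_mod (free R X).
Proof.
move=> A B f h im; pose k x := projT1 (cid (im (free_gen R x))).
have kE x : f (k x) = h (free_gen R x) by rewrite /k; case: cid.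
exists (free_lift k); apply: (@free_eq _ _ _ (f \o free_lift k) h) => x /=.
by rewrite free_lift_gen kE.
Qed.

Lemma prod_projective (P Q : lmodType R) :
  projective_mod P -> projective_mod Q -> projective_mod (P * Q)%type.
Proof.
move=> Pp Qp A B f h im.
have linP : linear (fun x : P => h (x, 0)).
  by move=> a x y; rewrite -linearP; congr (h (_, _)); rewrite /= scaler0 addr0.
have linQ : linear (fun x : Q => h (0, x)).
  by move=> a x y; rewrite -linearP; congr (h (_, _)); rewrite /= scaler0 addr0.
have [kP kPE] := Pp _ _ f (lin_of linP) (fun x => im (x, 0)).
have [kQ kQE] := Qp _ _ f (lin_of linQ) (fun x => im (0, x)).
have lin : linear (fun x : P * Q => kP x.1 + kQ x.2).
  by move=> a x y /=; rewrite !linearP scalerDr addrACA.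
exists (lin_of lin) => -[x y] /=; rewrite linearD kPE kQE /= -linearD.
by congr (h (_, _)); rewrite /= ?addr0 ?add0r.
Qed.

End Lifting.

(** * Injective dimension and exactness of Hom *)

Section Syzygies.
Variable R : pzRingType.

(** Injective dimension at most [n], unfolded into short exact sequences of cosyzygies, the form
    that dimension shifting consumes. *)
Fixpoint idim_le (n : nat) (W : lmodType R) : Prop :=
  if n is n'.+1 then
    exists (E W' : lmodType R) (i : {linear W -> E}) (p : {linear E -> W'}),
      [/\ injective_mod E, injective i, surj p, exact_at i p & idim_le n' W']
  else injective_mod W.

Lemma injective_iso (W E : lmodType R) (i : {linear W -> E}) :
  injective i -> surj i -> injective_mod E -> injective_mod W.
Proof.
move=> i_inj i_surj E_inj A B j f j_inj.
have [g gE] := E_inj _ _ j (i \o f) j_inj.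
have [h hE] := @factor_inj _ _ _ _ i g i_inj (fun x => i_surj (g x)).
by exists h => x; apply: i_inj; rewrite hE gE.
Qed.

Lemma injdim_idim (n : nat) (W : lmodType R) : injdim_le W n -> idim_le n W.
Proof.
elim: n W => [|n IHn] W [J Jtriv].
  apply: (@injective_iso _ (J 0%N) (ir_aug J)); first exact: ir_aug_inj.
    by move=> y; apply: (ir_exact0 y).1; apply: Jtriv.
  exact: ir_injective.
have dd x : ir_d J 1%N (ir_d J 0%N x) = 0 by apply: (ir_exact _).2; exists x.
have [p pE] := corestrict_ex dd.
exists (J 0%N), (kernel (ir_d J 1%N)), (ir_aug J), p; split.
- exact: ir_injective.
- exact: ir_aug_inj.
- move=> y; have [x xE] := (ir_exact (val y)).1 (ker_valP y).
  by exists x; apply: val_inj; rewrite pE.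
- move=> y; apply: iff_trans (ir_exact0 y); rewrite -pE.
  by split=> [->//|y0]; apply: val_inj.
apply: IHn.
have inj0 : injective (ker_val (ir_d J 1%N)) by exact: val_inj.
have ex0 : exact_at (ker_val (ir_d J 1%N)) (ir_d J 1%N).
  move=> y; split=> [/eqP y0|[x <-]]; last exact: ker_valP.
  by exists (Sub y y0).
(* The tail of [J] resolves the first cosyzygy, the kernel of [ir_d J 1], and ends one degree
   earlier. *)
exists (@InjectiveResolution _ _ (fun i => J i.+1) (ker_val (ir_d J 1%N))
  (fun i => ir_d J i.+1) (fun i => @ir_injective _ _ J i.+1) inj0 ex0
  (fun i => @ir_exact _ _ J i.+1)).
by move=> i ni; apply: Jtriv.
Qed.

(* The map [D] continues on the right to an exact sequence
   [T --D--> T' --> T_1 --> ... --> T_n] with [T_1, ..., T_n] projective. *)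
Fixpoint coresolved (n : nat) (T T' : lmodType R) (D : {linear T -> T'}) : Prop :=
  if n is n'.+1 then
    exists (T1 : lmodType R) (D1 : {linear T' -> T1}),
      [/\ exact_at D D1, projective_mod T1 & coresolved n' D1]
  else True.

(* Dimension shifting along the cosyzygies of [W]: an extension of [f] modulo the
   first injective is corrected by a map that factors through [T_1]. *)
Lemma hom_exact n (W T T' : lmodType R) (D : {linear T -> T'}) (f : {linear T -> W}) :
  idim_le n W -> coresolved n D -> (forall x, D x = 0 -> f x = 0) ->
  exists g : {linear T' -> W}, forall x, g (D x) = f x.
Proof.
elim: n W T T' D f => [|n IHn] W T T' D f /=.
  by move=> W_inj _; apply: injectivity_factor.
move=> [E [W' [i [p [E_inj i_inj p_surj ip idW']]]]] [T1 [D1 [DD1 prT1 co]]] Df.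
have Dif x : D x = 0 -> (i \o f) x = 0 by move=> /Df /= ->; rewrite linear0.
have [g gE] := injectivity_factor E_inj Dif.
have pg x : D1 x = 0 -> (p \o g) x = 0.
  by move=> /(DD1 x).1[y <-] /=; rewrite gE; apply: (ip _).2; exists (f y).
have [h hE] := IHn W' T' T1 D1 (p \o g) idW' co pg.
have [h' h'E] := prT1 _ _ p h (fun x => p_surj (h x)).
(* Subtracting [h' \o D1] leaves the values on the image of [D] unchanged and moves [g] into the
   kernel of [p], which is the image of [i]. *)
have lin : linear (fun x => g x - h' (D1 x)).
  by move=> a x y /=; rewrite !linearP scalerBr /= scalerN addrACA.
have [k kE] : exists k : {linear T' -> W}, forall x, i (k x) = lin_of lin x.
  by apply: factor_inj => // x; apply: (ip _).1; rewrite /= linearB h'E hE subrr.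
exists k => x; apply: i_inj; rewrite kE /= gE.
have -> : D1 (D x) = 0 by apply: (DD1 _).2; exists x.
by rewrite linear0 subr0.
Qed.

End Syzygies.

(** * Noetherian rings and finitely generated projectives *)

Section Noetherian.
Variable R : pzRingType.

Definition noetherian_mod (V : lmodType R) : Prop :=
  forall I : submodClosed V, fin_gen_sub (I : {pred V}).

Lemma fin_gen_surj (U V : lmodType R) (f : {linear U -> V}) :
  surj f -> fin_gen U -> fin_gen V.
Proof.
move=> fs [n [e [_ eE]]]; exists n, (f \o e); split=> // y _.
have [x <-] := fs y; have [c ->] := eE x isT; exists c.
by rewrite linear_sum; apply: eq_bigr => i _; rewrite linearZ.
Qed.

Lemma preim_submod (U V : lmodType R) (f : {linear U -> V}) (I : submodClosed V) :
  exists J : submodClosed U, forall x, (x \in J) = (f x \in I).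
Proof.
pose J : {pred U} := fun x => f x \in I.
have Jsub : subsemimod_closed J.
  split; first split.
  - by rewrite unfold_in /J linear0 rpred0.
  - by move=> x y; rewrite !unfold_in /J linearD; apply: (rpredD (S := I)).
  - by move=> a x; rewrite !unfold_in /J linearZ; apply: (rpredZ (s := I)).
pose Jm := GRing.isSubmodClosed.Build _ _ J Jsub.
by exists (HB.pack J Jm : submodClosed U).
Qed.

Lemma im_submod (U V : lmodType R) (f : {linear U -> V}) (I : submodClosed U) :
  exists J : submodClosed V, forall y, (y \in J) <-> exists2 x, x \in I & f x = y.
Proof.
pose J : {pred V} := fun y => `[< exists2 x, x \in I & f x = y >].
have JP y : (y \in J) <-> exists2 x, x \in I & f x = y.
  by split=> [/asboolP|?]; last apply/asboolP.
have Jsub : subsemimod_closed J.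
  split; first split.
  - by apply/JP; exists 0; [exact: rpred0 | exact: linear0].
  - move=> y z /JP[x Ix <-] /JP[w Iw <-]; apply/JP; exists (x + w).
      exact: (rpredD (S := I)).
    exact: linearD.
  - move=> a y /JP[x Ix <-]; apply/JP; exists (a *: x).
      exact: (rpredZ (s := I)).
    exact: linearZ.
pose Jm := GRing.isSubmodClosed.Build _ _ J Jsub.
by exists (HB.pack J Jm : submodClosed V).
Qed.

(** Generators of [I] are the images of generators of its preimage in [U], together with lifts to
    [I] of generators of its image in [W]. *)
Lemma noetherian_ext (U V W : lmodType R) (i : {linear U -> V}) (p : {linear V -> W}) :
  exact_at i p -> noetherian_mod U -> noetherian_mod W -> noetherian_mod V.
Proof.
move=> ip nU nW I.
have [J JE] := preim_submod i I; have [K KE] := im_submod p I.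
have [m [u [uJ uE]]] := nU J; have [n [w [wK wE]]] := nW K.
have [v vP] : exists v : 'I_n -> V, forall j, v j \in I /\ p (v j) = w j.
  have H j : exists x, x \in I /\ p x = w j.
    by have [x xI xw] := (KE (w j)).1 (wK j); exists x.
  by exists (fun j => projT1 (cid (H j))) => j; case: cid.
exists (m + n)%N, (fun k => match split k with inl j => i (u j) | inr j => v j end).
split=> [k|x xI].
  by case: split => j; [rewrite -JE; exact: uJ | exact: (vP j).1].
have [c cE] : exists c : 'I_n -> R, p x = \sum_j c j *: w j.
  by apply: wE; apply/KE; exists x.
have [y yE] : exists y, i y = x - \sum_j c j *: v j.
  apply: (ip _).1; rewrite linearB cE linear_sum; apply/eqP; rewrite subr_eq0.
  by apply/eqP/eq_bigr => j _; rewrite linearZ (vP j).2.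
have [b bE] : exists b : 'I_m -> R, y = \sum_j b j *: u j.
  apply: uE; rewrite JE yE; apply: (rpredD (S := I)) => //.
  rewrite -scaleN1r; apply: (rpredZ (s := I)).
  by apply: (rpred_sum (S := I)) => j _; apply: (rpredZ (s := I)); exact: (vP j).1.
exists (fun k => match split k with inl j => b j | inr j => c j end).
rewrite big_split_ord /= -[LHS](subrK (\sum_j c j *: v j)) -yE bE linear_sum.
congr (_ + _); apply: eq_bigr => j _.
  by rewrite (unsplitK (inl j)) linearZ.
by rewrite (unsplitK (inr j)).
Qed.

Lemma noetherian_span n (V : lmodType R) (e : 'I_n -> V) :
  noetherian R -> (forall x, exists c : 'I_n -> R, x = \sum_i c i *: e i) ->
  noetherian_mod V.
Proof.
move=> nR; elim: n V e => [|n IHn] V e eE.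
  have V0 (x : V) : x = 0 by have [c ->] := eE x; rewrite big_ord0.
  move=> I; exists 0%N, e; split=> [[]//|x _]; exists (fun=> 0).
  by rewrite big_ord0.
have lin : linear (fun a : R^o => (a : R) *: e ord0).
  by move=> a x y; rewrite scalerDl scalerA.
(* The kernel of the zero map is all of [R], so [J] is the cyclic submodule generated by [e ord0];
   the quotient by it needs one generator fewer. *)
have [J JE] := im_submod (lin_of lin) (ker_pred (\0 : {linear R^o -> R^o})).
have ex : exact_at (lin_of lin) (lproj J).
  move=> y; split=> [|[x <-]].
    by rewrite -(linear0 (lproj J)) => /lproj_eq; rewrite subr0 => /JE[x _]; exists x.
  by rewrite -(linear0 (lproj J)); apply/lproj_eq; rewrite subr0; apply/JE; exists x => //; exact: eqxx.
apply: (noetherian_ext ex) => //; apply: (IHn _ (fun i => lproj J (e (lift ord0 i)))).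
move=> q; have [x ->] := lproj_surj q; have [c ->] := eE x.
exists (fun i => c (lift ord0 i)).
rewrite big_ord_recl linearD (ex _).2 ?add0r; last by exists (c ord0).
by rewrite linear_sum; apply: eq_bigr => i _; rewrite linearZ.
Qed.

Lemma fin_gen_kernel (V W : lmodType R) (f : {linear V -> W}) :
  noetherian R -> fin_gen V -> fin_gen (kernel f).
Proof.
move=> nR [n [e [_ eE]]].
have [m [u [uK uE]]] := noetherian_span nR (fun x => eE x isT) (ker_pred f).
exists m, (fun i => Sub (u i) (uK i) : kernel f); split=> // x _.
have [c cE] := uE (val x) (valP x); exists c; apply: val_inj; rewrite cE.
rewrite (linear_sum (ker_val f)); apply: eq_bigr => i _.
by rewrite (linearZZ (ker_val f)).
Qed.

(** A finite dual basis: in this form the property passes to the dual module by exchanging the roles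
    of [e] and [c]. *)
Definition fg_projective (P : lmodType R) : Prop :=
  exists n (e : 'I_n -> P) (c : 'I_n -> {linear P -> R^o}),
    forall x, x = \sum_i (c i x : R) *: e i.

Lemma fg_projective_projective P : fg_projective P -> projective_mod P.
Proof.
move=> [n [e [c ceE]]] A B f h im.
pose k i := projT1 (cid (im (e i))).
have kE i : f (k i) = h (e i) by rewrite /k; case: cid.
have lin : linear (fun x => \sum_i (c i x : R) *: k i).
  move=> a x y; rewrite scaler_sumr -big_split; apply: eq_bigr => i _.
  by rewrite linearP scalerDl scalerA.
exists (lin_of lin) => x /=; rewrite [in RHS](ceE x) !linear_sum.
by apply: eq_bigr => i _; rewrite !linearZ kE.
Qed.

Lemma free_fg_projective n : fg_projective (free R 'I_n).
Proof.
pose c (i j : 'I_n) : R^o := (i == j)%:R.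
exists n, (fun i => free_gen R i), (fun i => free_lift (c i)) => x.
have lin : linear (fun x => \sum_i (free_lift (c i) x : R) *: free_gen R i).
  move=> a y z; rewrite scaler_sumr -big_split; apply: eq_bigr => i _.
  by rewrite linearP scalerDl scalerA.
apply: (@free_eq _ _ _ idfun (lin_of lin)) => {}x /=.
rewrite (bigD1 x) //= free_lift_gen /c eqxx scale1r big1 ?addr0 // => i ix.
by rewrite free_lift_gen (negPf ix) scale0r.
Qed.

End Noetherian.

(** * Duals of finitely generated projectives and reflexivity *)

Section DualPair.
Variables (R S : pzRingType).
Variables (phi : {rmorphism S -> R^c}) (psi : {rmorphism R -> S^c}).
Hypothesis phiK : forall s : S, psi (phi s) = s.
Hypothesis psiK : forall r : R, phi (psi r) = r.

Lemma dual_sumE (M : lmodType R) n (a : 'I_n -> dual phi M) x :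
  (\sum_i a i) x = \sum_i a i x.
Proof. by elim/big_rec2: _ => // i y z _ <-. Qed.

Lemma ev_linear (M : lmodType R) (x : M) :
  linear (fun a : dual phi M => psi (a x) : S^o).
Proof. by move=> s a b; rewrite rmorphD rmorphM phiK. Qed.

Definition ev (M : lmodType R) (x : M) : {linear dual phi M -> S^o} :=
  lin_of (ev_linear x).

Lemma evP (M : lmodType R) c (x y : M) a : ev (c *: x + y) a =
  (ev x a : S) * (psi c : S) + ev y a.
Proof. by rewrite /= linearP rmorphD rmorphM. Qed.

Section DualBasis.
Variables (P : lmodType R).
Hypothesis Pfg : fg_projective P.

Lemma dual_basis : exists n (e : 'I_n -> P) (c : 'I_n -> dual phi P),
  (forall x, x = \sum_i (c i x : R) *: e i) /\
  forall a, a = \sum_i (ev (e i) a : S) *: c i.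
Proof.
have [n [e [c ceE]]] := Pfg; exists n, e, c; split=> // a.
apply: linear_ext => x; rewrite dual_sumE {1}(ceE x) linear_sum.
by apply: eq_bigr => i _; rewrite linearZ /= psiK.
Qed.

Lemma fin_gen_dual : fin_gen (dual phi P).
Proof.
have [n [e [c [_ aE]]]] := dual_basis; exists n, c; split=> // a _.
by exists (fun i => ev (e i) a).
Qed.

Lemma dual_fg_projective : fg_projective (dual phi P).
Proof.
by have [n [e [c [_ aE]]]] := dual_basis; exists n, c, (fun i => ev (e i)).
Qed.

(** Surjective half of reflexivity: the coordinate functions generate the dual, so the values
    [th (c i)] determine [th] and serve as coefficients of the point. *)
Lemma dual_eval (th : {linear dual phi P -> S^o}) : exists p, th =1 ev p.
Proof.
have [n [e [c [_ aE]]]] := dual_basis.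
exists (\sum_i (phi (th (c i)) : R) *: e i) => a.
rewrite [in LHS](aE a) /= !linear_sum rmorph_sum; apply: eq_bigr => i _.
by rewrite !linearZ /= rmorphM phiK.
Qed.

(** Injective half of reflexivity: all coordinates of [p] vanish. *)
Lemma ev_eq0 (p : P) : (forall a, ev p a = 0) -> p = 0.
Proof.
have [n [e [c [xE _]]]] := dual_basis; move=> p0; rewrite (xE p) big1 // => i _.
have /(congr1 phi) := p0 (c i); rewrite /= psiK rmorph0 => ->.
by rewrite scale0r.
Qed.
End DualBasis.
End DualPair.

(** * Projective resolutions *)

Section Comparison.
Variable R : pzRingType.

Record projective_resolution (M : lmodType R) := ProjectiveResolution {
  pr_obj :> nat -> lmodType R;
  pr_aug : {linear pr_obj 0 -> M};
  pr_d : forall i, {linear pr_obj i.+1 -> pr_obj i};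
  pr_projective : forall i, projective_mod (pr_obj i);
  pr_aug_surj : surj pr_aug;
  pr_exact0 : exact_at (pr_d 0) pr_aug;
  pr_exact : forall i, exact_at (pr_d i.+1) (pr_d i) }.

Definition free_resolution (M : lmodType R) : projective_resolution M :=
  @ProjectiveResolution M (fun i => res i M) (aug M) (fun i => resd i M)
    (fun i => @free_projective R _) (@aug_surj R M) (@res_exact0 R M)
    (fun i => @res_exact R i M).

Section FinGen.
Hypothesis R_noeth : noetherian R.

(** The proof of finite generation travels with the module, so that passing to the kernel of a
    finite free cover can be iterated. *)
Definition fg_mod := {M : lmodType R | fin_gen M}.

Definition fg_rank (M : fg_mod) : nat := projT1 (cid (proj2_sig M)).

Definition fg_cover (M : fg_mod) : lmodType R := free R 'I_(fg_rank M).

Lemma fg_aug_exists (M : fg_mod) : exists f : {linear fg_cover M -> proj1_sig M}, surj f.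
Proof.
have [e [_ eE]] := projT2 (cid (proj2_sig M)).
exists (free_lift e) => y; have [c ->] := eE y isT.
exists (\sum_i c i *: free_gen R i).
by rewrite linear_sum; apply: eq_bigr => i _; rewrite linearZ /= free_lift_gen.
Qed.

Definition fg_aug (M : fg_mod) : {linear fg_cover M -> proj1_sig M} :=
  projT1 (cid (fg_aug_exists M)).

Lemma fg_aug_surj M : surj (fg_aug M).
Proof. exact: projT2 (cid (fg_aug_exists M)). Qed.

Lemma fg_cover_fg M : fin_gen (fg_cover M).
Proof.
have [n [e [c ceE]]] := free_fg_projective R (fg_rank M).
exists n, e; split=> // x _; exists (fun i => c i x); exact: ceE.
Qed.

Definition fg_next (M : fg_mod) : fg_mod :=
  exist (fun M : lmodType R => fin_gen M) (kernel (fg_aug M))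
    (fin_gen_kernel (fg_aug M) R_noeth (fg_cover_fg M)).

Lemma ker_val_exact (U V W : lmodType R) (p : {linear U -> V}) (q : {linear W -> kernel p}) :
  surj q -> exact_at (ker_val p \o q) p.
Proof.
move=> q_surj y; split=> [/eqP y0|[x <-]]; last exact: ker_valP.
by have [x xE] := q_surj (Sub y y0); exists x; rewrite /= xE.
Qed.

Lemma ker_val_exact_comp (U V W T : lmodType R) (p : {linear U -> V})
    (q : {linear W -> kernel p}) (r : {linear T -> W}) :
  exact_at r q -> exact_at r (ker_val p \o q).
Proof.
move=> rq y; apply: iff_trans (rq y).
by split=> [y0|/= ->]; [apply: val_inj | exact: (linear0 (ker_val p))].
Qed.

Lemma fg_resolution (M : lmodType R) : fin_gen M ->
  exists P : projective_resolution M, forall i, fg_projective (P i).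
Proof.
move=> Mfg; pose Z i := iter i fg_next (exist (fun M : lmodType R => fin_gen M) M Mfg).
pose d i : {linear fg_cover (Z i.+1) -> fg_cover (Z i)} :=
  ker_val (fg_aug (Z i)) \o fg_aug (Z i.+1).
have exact0 i : exact_at (d i) (fg_aug (Z i)).
  exact: (ker_val_exact (@fg_aug_surj (Z i.+1))).
have exactS i : exact_at (d i.+1) (d i).
  exact: (ker_val_exact_comp (p := fg_aug (Z i)) (exact0 i.+1)).
exists (@ProjectiveResolution M (fun i => fg_cover (Z i)) (fg_aug (Z 0%N)) d
  (fun i => @free_projective R _) (@fg_aug_surj _) (exact0 0%N) exactS) => i.
exact: free_fg_projective.
Qed.
End FinGen.

(** Inductive step shared by both homotopy arguments, for resolutions and for [ext_lift]: [s] lifts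
    the part of [a1 - a2] not accounted for by [h], and [h] dies after [d]. *)
Lemma homotopy_step (X' X C' C : lmodType R) (d : {linear X' -> X})
    (e : {linear C' -> C}) (a1 a2 h : {linear X -> C}) (b1 b2 : {linear X' -> C'}) :
  projective_mod X -> (forall x, exists y, e y = a1 x - a2 x - h x) ->
  (forall x, e (b1 x) = a1 (d x)) -> (forall x, e (b2 x) = a2 (d x)) ->
  (forall x, h (d x) = 0) ->
  exists s : {linear X -> C'}, forall x, e (b1 x - b2 x - s (d x)) = 0.
Proof.
move=> Xp im b1E b2E hd.
have [s sE] := Xp _ _ e (a1 \- a2 \- h) im; exists s => x.
by rewrite !linearB b1E b2E sE /= hd subr0 subrr.
Qed.

(** Coboundaries of the complex Hom(X, V); nothing enters degree 0, so there only zero qualifies.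
    Bare functions are allowed so that pointwise sums and composites need no bundling. *)
Definition cobounds (X : nat -> lmodType R) (d : forall i, {linear X i.+1 -> X i})
    (V : lmodType R) (i : nat) : (X i -> V) -> Prop :=
  match i with
  | 0 => fun h => forall x, h x = 0
  | j.+1 => fun h => exists u : {linear X j -> V}, forall x, h x = u (d j x)
  end.
Arguments cobounds {X} d {V} i h.

Lemma cobounds_ext (X : nat -> lmodType R) (d : forall i, {linear X i.+1 -> X i})
    (V : lmodType R) i (h h' : X i -> V) : h =1 h' -> cobounds d i h -> cobounds d i h'.
Proof.
by case: i h h' => [|i] h h' hh' /= => [h0 x|[u uE]]; [|exists u => x]; rewrite -hh'.
Qed.

Lemma coboundsD (X : nat -> lmodType R) (d : forall i, {linear X i.+1 -> X i})
    (V : lmodType R) i (h h' : X i -> V) :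
  cobounds d i h -> cobounds d i h' -> cobounds d i (fun x => h x + h' x).
Proof.
case: i h h' => [|i] h h' /= => [h0 h'0 x|[u uE] [u' u'E]].
  by rewrite h0 h'0 addr0.
by exists (u \+ u') => x; rewrite uE u'E.
Qed.

Lemma coboundsN (X : nat -> lmodType R) (d : forall i, {linear X i.+1 -> X i})
    (V : lmodType R) i (h : X i -> V) :
  cobounds d i h -> cobounds d i (fun x => - h x).
Proof.
case: i h => [|i] h /= => [h0 x|[u uE]]; first by rewrite h0 oppr0.
by exists (\- u) => x; rewrite uE.
Qed.

Lemma coboundsB (X : nat -> lmodType R) (d : forall i, {linear X i.+1 -> X i})
    (V : lmodType R) i (h h' : X i -> V) :
  cobounds d i h -> cobounds d i h' -> cobounds d i (fun x => h x - h' x).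
Proof. by move=> hb /coboundsN; apply: coboundsD. Qed.

Lemma cobounds_comp (X : nat -> lmodType R) (d : forall i, {linear X i.+1 -> X i})
    (V W : lmodType R) i (h : X i -> V) (f : {linear V -> W}) :
  cobounds d i h -> cobounds d i (fun x => f (h x)).
Proof.
case: i h => [|i] h /= => [h0 x|[u uE]]; first by rewrite h0 linear0.
by exists (f \o u) => x; rewrite /= uE.
Qed.

Section Resolutions.
Variables (M N : lmodType R) (X : projective_resolution M) (Y : projective_resolution N).

Lemma pr_dd i x : pr_d X i (pr_d X i.+1 x) = 0.
Proof. by apply: (pr_exact _).2; exists x. Qed.

Lemma pr_aug_d x : pr_aug X (pr_d X 0 x) = 0.
Proof. by apply: (pr_exact0 _).2; exists x. Qed.

Lemma cobounds_cocycle (V : lmodType R) i (h : X i -> V) x :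
  cobounds (pr_d X) i h -> h (pr_d X i x) = 0.
Proof. by case: i h x => [|i] h x //= [u ->]; rewrite pr_dd linear0. Qed.

(* [a] is the top component of a chain map over [f] truncated at degree [i]; only
   the existence of the lower components is recorded. *)
Fixpoint chain_lift (f : {linear M -> N}) (i : nat) : {linear X i -> Y i} -> Prop :=
  match i with
  | 0 => fun a => forall x, pr_aug Y (a x) = f (pr_aug X x)
  | j.+1 => fun a => exists a0 : {linear X j -> Y j}, chain_lift f a0 /\
      forall x, pr_d Y j (a x) = a0 (pr_d X j x)
  end.

Lemma chain_lift_next f i (a : {linear X i -> Y i}) : chain_lift f a ->
  exists b : {linear X i.+1 -> Y i.+1}, forall x, pr_d Y i (b x) = a (pr_d X i x).
Proof.
move=> fa; apply: (@pr_projective _ X i.+1 _ _ (pr_d Y i) (a \o pr_d X i)) => x /=.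
case: i a fa x => [|i] a /= => [aE|[a0 [_ aE]]] x.
  by apply: (pr_exact0 _).1; rewrite aE pr_aug_d linear0.
by apply: (pr_exact _).1; rewrite aE pr_dd linear0.
Qed.

Lemma chain_lift_exists f i : exists a : {linear X i -> Y i}, chain_lift f a.
Proof.
elim: i => [|i [a fa]].
  by apply: (@pr_projective _ X 0%N _ _ (pr_aug Y) (f \o pr_aug X)) => x; apply: pr_aug_surj.
by have [b bE] := chain_lift_next fa; exists b, a.
Qed.

(** A homotopy in weak form: [h] is the part coming through the differential of [X]; the rest takes
    values in boundaries of [Y] and is only described pointwise. *)
Lemma chain_lift_homotopy f i (a1 a2 : {linear X i -> Y i}) :
  chain_lift f a1 -> chain_lift f a2 ->
  exists2 h : {linear X i -> Y i}, cobounds (pr_d X) i h &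
    forall x, exists y, pr_d Y i y = a1 x - a2 x - h x.
Proof.
elim: i a1 a2 => [|i IHi] b1 b2 /=.
  move=> b1E b2E; exists \0 => // x; apply: (pr_exact0 _).1.
  by rewrite /= subr0 linearB b1E b2E subrr.
move=> [a1 [fa1 b1E]] [a2 [fa2 b2E]]; have [h hb hE] := IHi _ _ fa1 fa2.
have hd x : h (pr_d X i x) = 0 by apply: cobounds_cocycle.
have [s sE] := homotopy_step (@pr_projective _ X i) hE b1E b2E hd.
exists (s \o pr_d X i); first by exists s.
by move=> x; apply: (pr_exact _).1; exact: sE.
Qed.

(** The cocycle [g] kills the boundary part of the homotopy, and the other part is a coboundary. *)
Lemma chain_lift_cocycle f i (a1 a2 : {linear X i -> Y i}) (V : lmodType R)
    (g : {linear Y i -> V}) : (forall y, g (pr_d Y i y) = 0) ->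
  chain_lift f a1 -> chain_lift f a2 ->
  cobounds (pr_d X) i (fun x => g (a1 x) - g (a2 x)).
Proof.
move=> gd fa1 fa2; have [h hb hE] := chain_lift_homotopy fa1 fa2.
apply: cobounds_ext (cobounds_comp g hb) => x; have [y yE] := hE x.
have := gd y; rewrite yE !linearB => /eqP; rewrite subr_eq0 => /eqP-> //.
Qed.

Lemma cobounds_pullback f i (a : {linear X i -> Y i}) (V : lmodType R)
    (h : Y i -> V) : chain_lift f a -> cobounds (pr_d Y) i h ->
  cobounds (pr_d X) i (fun x => h (a x)).
Proof.
case: i a h => [|i] a h /= => [_ h0 x|[a0 [_ aE]] [u uE]]; first exact: h0.
by exists (u \o a0) => x; rewrite /= uE aE.
Qed.

Lemma cocycle_pullback f i (a : {linear X i -> Y i}) (V : lmodType R)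
    (h : {linear Y i -> V}) : chain_lift f a -> (forall y, h (pr_d Y i y) = 0) ->
  forall x, h (a (pr_d X i x)) = 0.
Proof. by move=> fa hd x; have [b <-] := chain_lift_next fa; rewrite hd. Qed.

End Resolutions.

Lemma chain_lift_comp (M : lmodType R) (X Y Z : projective_resolution M) i
    (a : {linear X i -> Y i}) (b : {linear Y i -> Z i}) :
  chain_lift idfun a -> chain_lift idfun b -> chain_lift idfun (b \o a : {linear X i -> Z i}).
Proof.
elim: i a b => [|i IHi] a b /=; first by move=> aE bE x; rewrite bE /= aE.
move=> [a0 [ca aE]] [b0 [cb bE]]; exists (b0 \o a0); split; first exact: IHi.
by move=> x; rewrite /= bE aE.
Qed.

Lemma chain_lift_id (M : lmodType R) (X : projective_resolution M) i :
  chain_lift idfun (idfun : {linear X i -> X i}).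
Proof. by elim: i => [|i IHi] //=; exists idfun. Qed.

Section SameModule.
Variables (M : lmodType R) (X Y : projective_resolution M) (i : nat).
Variables (a : {linear X i -> Y i}) (b : {linear Y i -> X i}).
Hypotheses (a_lift : chain_lift idfun a) (b_lift : chain_lift idfun b).

Lemma cobounds_roundtrip (V : lmodType R) (g : {linear X i -> V}) :
  (forall x, g (pr_d X i x) = 0) -> cobounds (pr_d X) i (fun x => g (b (a x)) - g x).
Proof.
move=> gd; exact: (chain_lift_cocycle gd (chain_lift_comp a_lift b_lift)
  (@chain_lift_id _ X i)).
Qed.

(** Independence of the resolution: the round trip through [Y] changes a cocycle only by a
    coboundary, and a bound found on [Y] pulls back along [a]. *)
Lemma acyclic_transfer (V : lmodType R) :
  (forall g : {linear Y i -> V}, (forall y, g (pr_d Y i y) = 0) ->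
     cobounds (pr_d Y) i g) ->
  forall g : {linear X i -> V}, (forall x, g (pr_d X i x) = 0) -> cobounds (pr_d X) i g.
Proof.
move=> Yac g gd; have gbd := cocycle_pullback b_lift gd.
have := coboundsB (cobounds_pullback a_lift (Yac (g \o b) gbd)) (cobounds_roundtrip gd).
by apply: cobounds_ext => x; rewrite /= opprB addrCA subrr addr0.
Qed.
End SameModule.

End Comparison.
Arguments cobounds {R X} d {V} i h.

(** * The biduality map *)

Section ExtClass.
Variables (R S : pzRingType) (phi : {rmorphism S -> R^c}).
Implicit Types M : lmodType R.

Definition ext_cls M n : {linear kernel (Ext_out phi M n) -> Ext_obj phi M n} :=
  lproj (bnd_pred (Ext_in phi M n) (Ext_out phi M n)).

(** A relation between cochains and classes, so that representatives need not carry their cocycle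
    proof. *)
Definition ext_class M n (u : dual phi (res n M)) (xi : Ext_obj phi M n) : Prop :=
  exists2 z : kernel (Ext_out phi M n), val z = u & ext_cls M n z = xi.

Lemma ext_class_ex M n (u : dual phi (res n M)) :
  Ext_out phi M n u = 0 -> exists xi, ext_class u xi.
Proof. by move=> /eqP u0; exists (ext_cls M n (Sub u u0)), (Sub u u0). Qed.

Lemma ext_class_surj M n (xi : Ext_obj phi M n) : exists u, ext_class u xi.
Proof. by have [z ->] := lproj_surj xi; exists (val z), z. Qed.

Lemma ext_class_cocycle M n (u : dual phi (res n M)) xi :
  ext_class u xi -> Ext_out phi M n u = 0.
Proof. by move=> [z <- _]; exact: (ker_valP z). Qed.

Lemma Ext_in_cobounds M n (u : dual phi (res n M)) :
  (exists w, Ext_in phi M n w = u) <-> cobounds (fun i => resd i M) n u.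
Proof.
case: n u => [|n] u /=; split.
- by move=> [_ <-].
- by move=> u0; exists 0; apply: linear_ext => x; rewrite u0.
- by move=> [w <-]; exists w.
- by move=> [w uE]; exists w; apply: linear_ext => x; rewrite uE.
Qed.

Lemma ext_class_eq M n (u v : dual phi (res n M)) xi zeta :
  ext_class u xi -> ext_class v zeta ->
  (xi = zeta <-> exists w, Ext_in phi M n w = u - v).
Proof.
move=> [z <- <-] [y <- <-]; apply: iff_trans (lproj_eq _ _ _) _.
by split=> [/bnd_predP|?]; last apply/bnd_predP.
Qed.

Lemma ext_class_map M M' (f : {linear M -> M'}) n (u : dual phi (res n M')) xi :
  ext_class u xi -> ext_class (Ext_cochain phi f n u) (Ext_map phi f n xi).
Proof.
move=> [z <- <-]; pose y : kernel (Ext_out phi M n) :=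
  ker_map (@Ext_cochain_out _ _ phi _ _ f n) z.
by exists y; last rewrite /ext_cls /= Ext_mapE.
Qed.

Definition Ext_vanishes M n : Prop :=
  forall u, Ext_out phi M n u = 0 -> exists w, Ext_in phi M n w = u.

Lemma trivial_Ext M n : trivial_mod (Ext_obj phi M n) <-> Ext_vanishes M n.
Proof.
split=> [tr u u0|va xi].
  have [xi uxi] := ext_class_ex u0.
  have [xi0 uxi0] := ext_class_ex (linear0 (Ext_out phi M n)).
  by rewrite -[u]subr0; apply: (ext_class_eq uxi uxi0).1; rewrite (tr xi) (tr xi0).
have [z ->] := lproj_surj xi; rewrite -(linear0 (ext_cls M n)); apply/lproj_eq.
by rewrite subr0; apply/bnd_predP/va; exact: (ker_valP z).
Qed.

End ExtClass.

Section ExtLift.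
Variables (R S : pzRingType) (phi : {rmorphism S -> R^c}).

(* [h] is the component [res i N -> dual (res k M)] of a lift of
   [g : N -> Ext^(i + k) M] to a chain map from [res N] to the dual of [res M]
   read backwards.  The accumulating addition makes [i.+1 + k] and [i + k.+1]
   convertible. *)
Fixpoint ext_lift (M : lmodType R) (N : lmodType S) (i k : nat) :
    {linear N -> Ext_obj phi M (NatTrec.add i k)} ->
    {linear res i N -> dual phi (res k M)} -> Prop :=
  match i return {linear N -> Ext_obj phi M (NatTrec.add i k)} ->
      {linear res i N -> dual phi (res k M)} -> Prop with
  | 0 => fun g h => forall q, ext_class (h q) (g (aug N q))
  | j.+1 => fun g h => exists h0 : {linear res j N -> dual phi (res k.+1 M)},
      @ext_lift M N j k.+1 g h0 /\ forall x, Ext_out phi M k (h x) = h0 (resd j N x)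
  end.

Section Basics.
Variables (M : lmodType R) (N : lmodType S).

Lemma resd_resd i (y : res i.+2 N) : resd i N (resd i.+1 N y) = 0.
Proof. by apply: (res_exact _).2; exists y. Qed.

(** For [i = 0] the element represents [g 0 = 0]; for [i > 0] it is a cocycle in degree [k < i + k],
    where Ext vanishes. *)
Lemma ext_lift_resd i k (g : {linear N -> Ext_obj phi M (NatTrec.add i k)}) h :
  (forall j, (j < i + k)%N -> Ext_vanishes phi M j) -> ext_lift g h ->
  forall x, exists w, Ext_in phi M k w = h (resd i N x).
Proof.
case: i g h => [|i] g h va; [move=> hE x | move=> [h0 [_ hE]] x].
  rewrite -[h _]subr0 -(linear0 h); apply/(ext_class_eq (hE _) (hE 0)).
  by rewrite linear0 (res_exact0 _).2 ?linear0 //; exists x.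
apply: va; first by rewrite addSn ltnS leq_addl.
by rewrite hE resd_resd linear0.
Qed.

Lemma ext_lift_exists i k (g : {linear N -> Ext_obj phi M (NatTrec.add i k)}) :
  (forall j, (j < i + k)%N -> Ext_vanishes phi M j) -> exists h, ext_lift g h.
Proof.
elim: i k g => [|i IHi] k g va.
  have [h hE] := @free_projective _ N _ _ (ext_cls phi M k) (g \o aug N) (fun x =>
    let: ex_intro z zE := lproj_surj (g (aug N x)) in ex_intro _ z (esym zE)).
  by exists (ker_val _ \o h) => q; exists (h q); rewrite ?hE.
rewrite addSnnS in va; have [h0 gh0] := IHi k.+1 g va.
have [h hE] := @free_projective _ (syz i.+1 N) _ _ (Ext_out phi M k) (h0 \o resd i N)
  (fun x => ext_lift_resd va gh0 x).
by exists h, h0.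
Qed.

Lemma ext_lift_homotopy i k (g : {linear N -> Ext_obj phi M (NatTrec.add i k)}) h1 h2 :
  (forall j, (j < i + k)%N -> Ext_vanishes phi M j) ->
  ext_lift g h1 -> ext_lift g h2 ->
  exists2 h : {linear res i N -> dual phi (res k M)},
    cobounds (fun i => resd i N) i h &
    forall q, exists w, Ext_in phi M k w = h1 q - h2 q - h q.
Proof.
elim: i k g h1 h2 => [|i IHi] k g h1 h2 va.
  move=> h1E h2E; exists \0 => // q; rewrite /= subr0.
  exact/(ext_class_eq (h1E q) (h2E q)).
move=> [a1 [ga1 h1E]] [a2 [ga2 h2E]].
have va' : forall j, (j < i + k.+1)%N -> Ext_vanishes phi M j by rewrite -addSnnS.
have [h hb hE] := IHi k.+1 g a1 a2 va' ga1 ga2.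
have hd x : h (resd i N x) = 0 by apply: (cobounds_cocycle (X := free_resolution N) x hb).
have [s sE] := homotopy_step (@free_projective _ (syz i N)) hE h1E h2E hd.
exists (s \o resd i N); first by exists s.
by move=> x; apply: va; [rewrite addSn ltnS leq_addl | exact: sE].
Qed.

End Basics.

Lemma ext_lift_cochain (M M' : lmodType R) (N : lmodType S) (f : {linear M -> M'}) i k
    (g : {linear N -> Ext_obj phi M' (NatTrec.add i k)})
    (g' : {linear N -> Ext_obj phi M (NatTrec.add i k)}) h :
  (forall x, g' x = Ext_map phi f _ (g x)) -> ext_lift g h ->
  ext_lift g' (Ext_cochain phi f k \o h).
Proof.
elim: i k g g' h => [|i IHi] k g g' h g'E.
  by move=> hE q; rewrite g'E; apply: ext_class_map.
move=> [h0 [gh0 hE]]; exists (Ext_cochain phi f k.+1 \o h0).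
split; first exact: (IHi k.+1 g g' h0 g'E gh0).
by move=> x; rewrite /= -Ext_cochain_out hE.
Qed.

Lemma ext_lift_res_map (M : lmodType R) (N N' : lmodType S) (l : {linear N' -> N}) i k
    (g : {linear N -> Ext_obj phi M (NatTrec.add i k)})
    (g' : {linear N' -> Ext_obj phi M (NatTrec.add i k)}) h :
  (forall x, g' x = g (l x)) -> ext_lift g h -> ext_lift g' (h \o res_map l i).
Proof.
elim: i k g g' h => [|i IHi] k g g' h g'E.
  by move=> hE q; rewrite g'E -aug_nat; apply: hE.
move=> [h0 [gh0 hE]]; exists (h0 \o res_map l i); split; first exact: (IHi k.+1 g).
by move=> x; rewrite /= hE res_map_nat.
Qed.

End ExtLift.

Section Biduality.
Variables (R S : pzRingType).
Variables (phi : {rmorphism S -> R^c}) (psi : {rmorphism R -> S^c}).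
Hypothesis phiK : forall s : S, psi (phi s) = s.
Hypothesis psiK : forall r : R, phi (psi r) = r.

Section Transpose.
Variables (X : lmodType S) (Y : lmodType R) (h : {linear X -> dual phi Y}).

Definition transpose_fun (y : Y) : dual psi X := ev phiK y \o h.

Lemma transpose_linear : linear transpose_fun.
Proof. by move=> a x y; apply: linear_ext => z; exact: evP. Qed.

Definition transpose : {linear Y -> dual psi X} := lin_of transpose_linear.

Lemma transposeE y x : transpose y x = psi (h x y).
Proof. by []. Qed.
End Transpose.

Section Eta.
Variables (M : lmodType R) (N : lmodType S).

(** Moving the differential from [y] to the other side of the pairing turns [h] into the next
    component [h0] composed with [resd]; for [i = 0] the values of [h] are cocycles and the result
    is zero. *)
Lemma ext_lift_cobounds i k (g : {linear N -> Ext_obj phi M (NatTrec.add i k)}) h y :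
  ext_lift g h -> cobounds (fun i => resd i N) i (transpose h (resd k M y)).
Proof.
case: i g h => [|i] g h.
  move=> hE x; have /(congr1 (fun u : dual phi _ => u y)) := ext_class_cocycle (hE x).
  by rewrite transposeE => /= ->; rewrite rmorph0.
move=> [h0 [_ hE]]; exists (transpose h0 y) => x.
by rewrite [RHS]transposeE -hE.
Qed.

Lemma eta_exists t (g : {linear N -> Ext_obj phi M (NatTrec.add t 0)}) h :
  (forall j, (j < t)%N -> Ext_vanishes phi M j) -> ext_lift g h ->
  exists eta : {linear M -> Ext_obj psi N t},
    forall p, ext_class (transpose h p) (eta (aug M p)).
Proof.
move=> va gh; have va0 j : (j < t + 0)%N -> Ext_vanishes phi M j by rewrite addn0; apply: va.
(* With [k = 0] the map [Ext_in] is zero, so [ext_lift_resd] says that [h] vanishes on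
   boundaries. *)
have cocyc p : Ext_out psi N t (transpose h p) = 0.
  apply: linear_ext => x.
  have [w /= wE] := ext_lift_resd va0 gh x; rewrite [LHS]/=.
  by rewrite -[h _]wE /= rmorph0.
have [k kE] := corestrict_ex cocyc.
have kaug p : aug M p = 0 -> (ext_cls psi N t \o k) p = 0.
  move=> /(res_exact0 p).1[y <-]; rewrite /= -(linear0 (ext_cls psi N t)).
  apply/lproj_eq; rewrite subr0; apply/bnd_predP; rewrite kE.
  by apply/Ext_in_cobounds; exact: (ext_lift_cobounds y gh).
have [eta etaE] := factor_surj (@aug_surj R M) kaug.
by exists eta => p; exists (k p); rewrite ?etaE.
Qed.

(** The two lifts are homotopic, and [Ext_in] is zero in degree 0, so [h1 - h2] is itself a
    coboundary; evaluating at [p] keeps it one. *)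
Lemma transpose_unique t (g : {linear N -> Ext_obj phi M (NatTrec.add t 0)}) h1 h2 p xi1 xi2 :
  (forall j, (j < t)%N -> Ext_vanishes phi M j) -> ext_lift g h1 -> ext_lift g h2 ->
  ext_class (transpose h1 p) xi1 -> ext_class (transpose h2 p) xi2 -> xi1 = xi2.
Proof.
move=> va gh1 gh2 c1 c2; apply/(ext_class_eq c1 c2)/Ext_in_cobounds.
have va0 j : (j < t + 0)%N -> Ext_vanishes phi M j by rewrite addn0; apply: va.
have [h hb hE] := ext_lift_homotopy va0 gh1 gh2.
apply: cobounds_ext (cobounds_comp (ev phiK p) hb) => x.
have [w wE] := hE x; have := congr1 (fun u : dual phi _ => u p) wE.
move=> /= /esym/eqP; rewrite subr_eq0 => /eqP hxE.
by rewrite /= -hxE; exact: (rmorphB psi (h1 x p) (h2 x p)).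
Qed.
End Eta.

(** The degree stays in the form [NatTrec.add t 0] imposed by [ext_lift]; it becomes [t] only in
    [Ext_duality_half]. *)
Definition is_biduality t (M : lmodType R)
    (eta : {linear M -> Ext_obj psi (Ext_obj phi M (NatTrec.add t 0)) t}) : Prop :=
  exists2 h, ext_lift (idfun : {linear Ext_obj phi M (NatTrec.add t 0) -> _}) h &
    forall p, ext_class (transpose h p) (eta (aug M p)).

Lemma biduality_exists t M : (forall j, (j < t)%N -> Ext_vanishes phi M j) ->
  exists eta, @is_biduality t M eta.
Proof.
move=> va; have va0 j : (j < t + 0)%N -> Ext_vanishes phi M j by rewrite addn0; apply: va.
have [h gh] := ext_lift_exists idfun va0.
by have [eta etaE] := eta_exists va gh; exists eta, h.
Qed.

(** Pushing [h'] forward along [f] and pulling [h] back along [g] both give lifts of the same map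
    [g], so their transposes have equal classes. *)
Lemma biduality_natural t (M M' : lmodType R) eta eta' (f : {linear M -> M'}) x :
  (forall j, (j < t)%N -> Ext_vanishes phi M j) ->
  is_biduality (t := t) eta -> is_biduality (t := t) eta' ->
  eta' (f x) = Ext_map psi (Ext_map phi f (NatTrec.add t 0)) t (eta x).
Proof.
move=> va [h gh etaE] [h' gh' eta'E]; have [p <-] := aug_surj x.
pose g := Ext_map phi f (NatTrec.add t 0).
have lift1 : ext_lift g (Ext_cochain phi f 0 \o h') by apply: ext_lift_cochain gh'.
have lift2 : ext_lift g (h \o res_map g t) by apply: ext_lift_res_map gh.
apply: (transpose_unique (p := p) va lift1 lift2).
  rewrite -aug_nat; have -> : transpose (Ext_cochain phi f 0 \o h') p =
    transpose h' (free_map R f p) by apply: linear_ext.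
  exact: eta'E.
have -> : transpose (h \o res_map g t) p = Ext_cochain psi g t (transpose h p).
  exact: linear_ext.
exact: ext_class_map.
Qed.
End Biduality.

(** * The cone and its dual *)

Section Shift.
Variables (R : pzRingType) (X : nat -> lmodType R).
Variable d : forall i, {linear X i.+1 -> X i}.

(* Padding with a zero module spares the two ends of the cone a separate treatment. *)
Definition shift (i : nat) : lmodType R :=
  if i is j.+1 then X j else free R 'I_0.

Definition shift_d (i : nat) : {linear shift i.+1 -> shift i} :=
  if i is j.+1 then d j else \0.

Lemma shift0_eq0 (x : shift 0) : x = 0.
Proof.
apply: (@free_eq _ _ _ idfun (\0 : {linear free R 'I_0 -> free R 'I_0})) => -[] //.
Qed.

Lemma cobounds_shift (V : lmodType R) i (h : X i -> V) :
  cobounds d i h <-> exists u : {linear shift i -> V}, forall x, h x = u (shift_d i x).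
Proof.
case: i h => [|i] h //=; split=> [h0|[u uE] x]; last by rewrite uE linear0.
by exists \0 => x; rewrite h0.
Qed.

Lemma shift_projective i : (forall i, projective_mod (X i)) -> projective_mod (shift i).
Proof. by case: i => [|i] Xp; [exact: free_projective | exact: Xp]. Qed.

Lemma shift_fg_projective i :
  (forall i, fg_projective (X i)) -> fg_projective (shift i).
Proof. by case: i => [|i] Xp; [exact: free_fg_projective | exact: Xp]. Qed.
End Shift.

Lemma resolution_coresolved (R : pzRingType) (M : lmodType R)
    (P : projective_resolution M) n m : (n <= m)%N -> coresolved n (pr_d P m).
Proof.
elim: n m => [|n IHn] [|m] //= nm; exists (P m), (pr_d P m).
by split; [exact: pr_exact | exact: pr_projective | exact: IHn].
Qed.

Section Cone.
Variables (R S : pzRingType).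
Variables (phi : {rmorphism S -> R^c}) (psi : {rmorphism R -> S^c}).
Hypothesis phiK : forall s : S, psi (phi s) = s.
Hypothesis psiK : forall r : R, phi (psi r) = r.
Variables (M : lmodType R) (N : lmodType S) (P : projective_resolution M).
Hypothesis P_fg : forall i, fg_projective (P i).
Variable t : nat.
Hypothesis M_vanish : forall j, (j < t)%N -> Ext_vanishes phi M j.
Hypothesis R_idim : idim_le t R^o.

Notation F := (free_resolution M).
Notation Q := (shift (fun i => res i N)).
Notation dQ := (shift_d (fun i => resd i N)).
Notation A k := (dual phi (shift P k)).
Notation dA k := (dual_map phi (shift_d (pr_d P) k) : {linear A k -> A k.+1}).

(** The index is shifted: [A k.+1] is the dual of [P k]. Below [t] the vanishing of Ext is
    transferred from the free resolution; above [t] the injective dimension of [R] gives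
    exactness. *)
Lemma dual_exact k (a : dual phi (P k)) :
  k != t -> (forall x, a (pr_d P k x) = 0) -> exists b, dA k b = a.
Proof.
move=> kt ad; suff : cobounds (pr_d P) k a.
  by move=> /cobounds_shift[b bE]; exists b; apply: linear_ext => x; rewrite bE.
case: (ltngtP k t) kt => // [kt|tk] _.
  have [al al_lift] := chain_lift_exists P F idfun k.
  have [be be_lift] := chain_lift_exists F P idfun k.
  apply: (acyclic_transfer al_lift be_lift) ad => u ud.
  by apply/Ext_in_cobounds/M_vanish => //; apply: linear_ext.
case: k a ad tk => // k a ad tk.
have co : coresolved t (pr_d P k) by apply: resolution_coresolved.
have [x /(pr_exact x).1[y <-]|u uE] := hom_exact (f := a) R_idim co; first exact: ad.
by exists u => x; rewrite uE.
Qed.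

Lemma dAdA k b : dA k.+1 (dA k b) = 0.
Proof.
apply: linear_ext => x /=; case: k b x => [|k] b x /=; first by rewrite linear0.
by rewrite pr_dd linear0.
Qed.

Lemma dA_projective k : projective_mod (A k).
Proof.
apply/fg_projective_projective/(dual_fg_projective phiK psiK).
exact: shift_fg_projective.
Qed.

(** The first exactness needed is at [A k.+1], the dual of [P k], whence the strict bound on [k]. *)
Lemma dA_coresolved n k : (t < k)%N -> coresolved n (dA k).
Proof.
elim: n k => [|n IHn] k // tk; exists (A k.+2), (dA k.+1).
split; [|exact: dA_projective|by apply: IHn; apply: ltnW].
move=> a; split=> [a0|[b <-]]; last exact: dAdA.
apply: dual_exact; first by rewrite gtn_eqF.
by move=> x; have := congr1 (fun u : dual phi _ => u x) a0.
Qed.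

Lemma dQ_resd i x : dQ i (resd i N x) = 0.
Proof. by case: i x => [|i] x //; exact: resd_resd. Qed.

(* The differential of the mapping cone of a chain map [res N -> A] with component [h]. *)
Definition cone_fun i k (h : {linear Q i.+1 -> A k.+1}) (x : Q i.+1 * A k) : Q i * A k.+1 :=
  (dQ i x.1, h x.1 - dA k x.2).

Lemma cone_linear i k h : linear (@cone_fun i k h).
Proof.
move=> c x y; rewrite /cone_fun !linearP /=; congr (_, _).
by rewrite addrACA -scalerDr.
Qed.

Definition cone i k h := lin_of (@cone_linear i k h).

(** Lifts take values in the dual of the canonical free resolution; [pull] moves them to the dual of
    the finitely generated one, where reflexivity is available. *)
Definition pull i k (al : {linear P k -> F k}) (h : {linear res i N -> dual phi (res k M)}) :
  {linear Q i.+1 -> A k.+1} := dual_map phi al \o h.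

(** The class of [a] is hit by [g], hence represented by some [h q]; comparing resolutions in both
    directions costs only coboundaries. *)
Lemma pull_surj k (g : {linear N -> Ext_obj phi M (NatTrec.add 0 k)}) h al
    (a : dual phi (P k)) :
  surj g -> ext_lift g h -> chain_lift (X := P) (Y := F) idfun al ->
  (forall x, a (pr_d P k x) = 0) ->
  exists q b, a = pull al h q - dA k b.
Proof.
move=> g_surj gh al_lift ad; have [be be_lift] := chain_lift_exists F P idfun k.
pose abe : dual phi (res k M) := (a : {linear P k -> R^o}) \o be.
have abe0 : Ext_out phi M k abe = 0.
  by apply: linear_ext => x; exact: (cocycle_pullback be_lift ad).
have [xi cxi] := ext_class_ex abe0; have [y yE] := g_surj xi.
have [q qE] := @aug_surj _ N y.
have /Ext_in_cobounds := (ext_class_eq (gh q) cxi).1 (etrans (congr1 g qE) yE).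
move=> /(cobounds_pullback (Y := F) al_lift) c1.
have c2 := cobounds_roundtrip al_lift be_lift ad.
have /cobounds_shift[b bE] := coboundsD c1 c2.
exists q, b; apply: linear_ext => x; rewrite /= -bE.
by rewrite [(_ - abe : dual _ _) _]/= addrA subrK opprB addrCA subrr addr0.
Qed.

Lemma pull_inj k (g : {linear N -> Ext_obj phi M (NatTrec.add 0 k)}) h al q b :
  injective g -> ext_lift g h -> chain_lift (X := P) (Y := F) idfun al ->
  pull al h q = dA k b -> aug N q = 0.
Proof.
move=> g_inj gh al_lift qb; have [be be_lift] := chain_lift_exists F P idfun k.
have hq0 x : h q (pr_d F k x) = 0.
  by have := congr1 (fun u : dual phi _ => u x) (ext_class_cocycle (gh q)).
have : cobounds (pr_d P) k (pull al h q).
  by apply/cobounds_shift; exists b => x; rewrite qb.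
move=> /(cobounds_pullback be_lift) c1.
have c2 := coboundsB c1 (cobounds_roundtrip be_lift al_lift hq0).
apply: g_inj; rewrite linear0 -(linear0 (ext_cls phi M k)).
have c0 : ext_class 0 (ext_cls phi M k 0) by exists 0.
apply/(ext_class_eq (gh q) c0)/Ext_in_cobounds; rewrite subr0.
by apply: cobounds_ext c2 => x; rewrite /= opprB addrCA subrr addr0.
Qed.

(** Exactness of the resolution of [N] suffices for [i > 0]; for [i = 0] injectivity of [g] replaces
    the augmentation, which is absent from the cone. *)
Lemma cone_resd i k (g : {linear N -> Ext_obj phi M (NatTrec.add i k)}) h al q a :
  injective g -> ext_lift g h -> chain_lift (X := P) (Y := F) idfun al ->
  dQ i q = 0 -> pull al h q = dA k a -> exists q', resd i N q' = q.
Proof.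
case: i g h q => [|i] g h q g_inj gh al_lift q0 qa.
  by apply: (res_exact0 _).1; exact: (pull_inj g_inj gh al_lift qa).
by apply: (res_exact _).1.
Qed.

(** [E] is the next differential of the cone, and [coresolved] states exactness from there on. The
    map [io] records that on the summand [A] it factors through [dA], which is needed to read off
    functionals. *)
Lemma cone_exact i k (g : {linear N -> Ext_obj phi M (NatTrec.add i k)}) h al :
  (i + k = t)%N -> bijective g -> ext_lift g h ->
  chain_lift (X := P) (Y := F) idfun al ->
  exists (X : lmodType S) (E : {linear (Q i * A k.+1)%type -> X})
    (io : {linear A k.+2 -> X}),
  [/\ exact_at (cone (pull al h)) E, projective_mod X,
      forall n, coresolved n E & forall a, E (0, a) = io (dA k.+1 a)].
Proof.
move=> ikt g_bij; have g_inj := bij_inj g_bij.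
have g_surj : surj g by case: g_bij => f _ gf y; exists (f y).
elim: i k g h al ikt g_inj g_surj {g_bij} => [|i IHi] k g h al ikt g_inj g_surj gh al_lift.
  have kt : k = t by [].
  have lin : linear (fun x : Q 0 * A k.+1 => dA k.+1 x.2).
    by move=> c x y; rewrite -linearP.
  (* As [Q 0] is zero, the cone continues as the complex [A] alone, past degree [t]. *)
  exists (A k.+2), (lin_of lin), idfun; split=> //.
  - move=> [q a]; split=> /= [a0|[[x b] [_ <-]]].
      have [x|x [b abx]] := pull_surj (a := a) g_surj gh al_lift.
        by have := congr1 (fun u : dual phi _ => u x) a0.
      by exists (x, b); congr (_, _); [rewrite [q]shift0_eq0 | rewrite abx].
    have hx0 z : h x (pr_d F k z) = 0.
      by have := congr1 (fun u : dual phi _ => u z) (ext_class_cocycle (gh x)).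
    rewrite linearB [X in _ - X]dAdA subr0; apply: linear_ext => y.
    exact: (cocycle_pullback al_lift hx0 y).
  - exact: dA_projective.
  - case=> // n; exists (A k.+3), (dA k.+2).
    split; [|exact: dA_projective|by apply: dA_coresolved; rewrite kt ltnW].
    move=> a; split=> [a0|[b <-]]; last exact: dAdA.
    have kt1 : k.+1 != t by rewrite kt gtn_eqF.
    have [x|b bE] := dual_exact (a := a) kt1.
      by have := congr1 (fun u : dual phi _ => u x) a0.
    by exists (0, b).
have [h0 [gh0' hE]] := gh; have gh0 : ext_lift (i := i) (k := k.+1) g h0 := gh0'.
have [al1 al1E] := chain_lift_next al_lift.
have al1_lift : chain_lift (X := P) (Y := F) (i := k.+1) idfun al1 by exists al.
have [X [E [io [ex Xp co EE]]]] := IHi k.+1 g h0 al1 (etrans (esym (addSnnS i k)) ikt)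
  g_inj g_surj gh0 al1_lift.
have comm x : dA k.+1 (pull al h x) = pull al1 h0 (resd i N x).
  apply: linear_ext => y; rewrite /= -al1E.
  by have := congr1 (fun u : dual phi _ => u (al1 y)) (hE x).
(* The sign is the one that the cone puts on the differential of [A]. *)
have linio : linear (fun a : A k.+2 => (0, - a) : Q i * A k.+2).
  by move=> c x y; congr (_, _); rewrite /= ?scaler0 ?addr0 // opprD scalerN.
exists (Q i * A k.+2)%type, (cone (pull al1 h0)), (lin_of linio); split=> //.
- move=> [q a]; split=> [qa0|[[x b] <-]].
    have q0 : dQ i q = 0 := congr1 fst qa0.
    have /eqP := congr1 snd qa0 : pull al1 h0 q - dA k.+1 a = 0.
    rewrite subr_eq0 => /eqP qa.
    have [x xq] := @cone_resd i k.+1 g h0 al1 q a g_inj gh0 al1_lift q0 qa.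
    have kt : k != t by rewrite -ikt neq_ltn addSn ltnS leq_addl.
    (* The remaining defect is a cocycle in a degree below [t], hence a coboundary. *)
    have [y|b bE] := dual_exact (a := pull al h x - a) kt.
      have := congr1 (fun u : dual phi _ => u y) (comm x); rewrite xq qa => /= cE.
      by apply/eqP; rewrite subr_eq0; apply/eqP.
    by exists (x, b); congr (_, _); rewrite // bE opprB addrC subrK.
  congr (_, _).
    exact: dQ_resd.
  have e : dA k.+1 (pull al h x - dA k b) = pull al1 h0 (resd i N x).
    by rewrite linearB [X in _ - X]dAdA subr0 comm.
  by apply/eqP; rewrite subr_eq0; apply/eqP; exact: esym e.
- apply: prod_projective; last exact: dA_projective.
  by apply: shift_projective => j; exact: free_projective.
- by case=> // n; exists X, E; split.
- by move=> a; congr (_, _); rewrite /= ?linear0 ?sub0r.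
Qed.

Variable s : nat.
Hypothesis S_idim : idim_le s S^o.

Lemma functional_split i k (u : {linear (Q i * A k.+1)%type -> S^o}) :
  exists (u1 : {linear Q i -> S^o}) (p : P k), forall q a, u (q, a) = u1 q + psi (a p).
Proof.
have lin1 : linear (fun q : Q i => u (q, 0)).
  by move=> c x y; rewrite -linearP; congr (u (_, _)); rewrite /= scaler0 addr0.
have lin2 : linear (fun a : A k.+1 => u (0, a)).
  by move=> c x y; rewrite -linearP; congr (u (_, _)); rewrite /= scaler0 addr0.
have [p pE] := dual_eval phiK psiK (P_fg k) (lin_of lin2).
exists (lin_of lin1), p => q a; have := pE a; rewrite /= => <-.
by rewrite -linearD; congr (u (_, _)); rewrite /= ?addr0 ?add0r.
Qed.

Section Stage.
Variables (i k : nat) (g : {linear N -> Ext_obj phi M (NatTrec.add i k)}).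
Variables (h : {linear res i N -> dual phi (res k M)}) (al : {linear P k -> F k}).
Hypotheses (ikt : (i + k)%N = t) (g_bij : bijective g) (gh : ext_lift g h).
Hypothesis al_lift : chain_lift (X := P) (Y := F) idfun al.

(** Extended by zero to [A k], the cocycle kills the kernel of the cone differential, so it factors
    through it by [hom_exact]. Splitting the resulting functional and setting one of the two
    arguments to zero gives the two claims. *)
Lemma cocycle_decomposition (xi : {linear res i N -> S^o}) :
  (forall x, xi (resd i N x) = 0) ->
  exists (u : {linear Q i -> S^o}) (p : P k),
    (forall q, xi q = u (dQ i q) + psi (h q (al p))) /\ forall b : A k, dA k b p = 0.
Proof.
move=> xid; have lin : linear (fun x : Q i.+1 * A k => xi x.1).
  by move=> c x y; rewrite -linearP.
have [X [E [io [ex Xp co _]]]] := cone_exact ikt g_bij gh al_lift.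
have co' : coresolved s (cone (pull al h)).
  by case: (s) => // n; exists X, E; split.
have ker x : cone (pull al h) x = 0 -> lin_of lin x = 0.
  case: x => q a qa0; have q0 : dQ i q = 0 := congr1 fst qa0.
  have /eqP := congr1 snd qa0 : pull al h q - dA k a = 0.
  rewrite subr_eq0 => /eqP qa.
  by have [x <-] := cone_resd (bij_inj g_bij) gh al_lift q0 qa; exact: xid.
have [w wE] := hom_exact S_idim co' ker.
have [u [p upE]] := functional_split w.
have xiE q a : xi q = u (dQ i q) + psi ((pull al h q - dA k a) p).
  by rewrite -upE; rewrite (wE (q, a)).
exists u, p; split=> [q|b].
  by rewrite (xiE q 0) linear0 subr0.
have := xiE 0 b; rewrite !linear0 sub0r add0r => /esym/(congr1 phi).
by rewrite psiK rmorph0 /= => /eqP; rewrite oppr_eq0 => /eqP.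
Qed.

(** The functional given by [u] and [- p] kills the image of the cone differential, so it factors
    through [E]; on the summand [A] this exhibits [p] as a boundary, by reflexivity. *)
Lemma transpose_coboundary (u : {linear Q i -> S^o}) (p : P k) :
  (forall q, psi (h q (al p)) = u (dQ i q)) -> (forall b : A k, dA k b p = 0) ->
  exists p', p = pr_d P k p'.
Proof.
move=> uE bp; have [X [E [io [ex Xp co EE]]]] := cone_exact ikt g_bij gh al_lift.
have lin : linear (fun x : Q i * A k.+1 => u x.1 - ev phiK p x.2).
  by move=> c x y; rewrite !linearP addrACA -scalerDr.
have ker x : E x = 0 -> lin_of lin x = 0.
  move=> /(ex x).1[[z b] <-].
  have e : (pull al h z - dA k b) p = h z (al p).
    by rewrite -[RHS]subr0 -(bp b).
  rewrite [LHS](_ : _ = u (dQ i z) - psi ((pull al h z - dA k b) p)) //.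
  by rewrite e uE subrr.
have [v vE] := hom_exact S_idim (co s) ker.
have [p' p'E] := dual_eval phiK psiK (P_fg k.+1) (v \o io).
exists (- p'); apply/eqP; rewrite linearN -subr_eq0 opprK; apply/eqP.
apply: (ev_eq0 (phiK := phiK) psiK (P_fg k)) => a.
have := vE (0, a); rewrite EE -[LHS]/((v \o io) _) p'E /= linear0 sub0r => e.
by rewrite linearD rmorphD [X in _ + X]e subrr.
Qed.

End Stage.

End Cone.

(** * Finite generation of Ext and Ext of the zero module *)

Section ExtFinite.
Variables (R S : pzRingType) (phi : {rmorphism S -> R^c}) (psi : {rmorphism R -> S^c}).
Hypothesis phiK : forall s : S, psi (phi s) = s.
Hypothesis psiK : forall r : R, phi (psi r) = r.

(** Computed on [P], the cocycles form a submodule of a finitely generated module over the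
    Noetherian ring [S], and they map onto Ext. *)
Lemma fin_gen_Ext (M : lmodType R) n :
  noetherian R -> noetherian S -> fin_gen M -> fin_gen (Ext_obj phi M n).
Proof.
move=> nR nS Mfg; have [P P_fg] := fg_resolution nR Mfg.
have [al al_lift] := chain_lift_exists P (free_resolution M) idfun n.
have [be be_lift] := chain_lift_exists (free_resolution M) P idfun n.
pose dP : {linear dual phi (P n) -> dual phi (P n.+1)} := dual_map phi (pr_d P n).
pose f : {linear kernel dP -> dual phi (res n M)} := dual_map phi be \o ker_val dP.
have f0 a : Ext_out phi M n (f a) = 0.
  apply: linear_ext => x; have [b bE] := chain_lift_next be_lift.
  have := congr1 (fun u : dual phi _ => u (b x)) (ker_valP a).
  by rewrite /= bE.
have [k kE] := corestrict_ex f0.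
have kerfg : fin_gen (kernel dP).
  by apply: fin_gen_kernel => //; apply: (fin_gen_dual phiK psiK).
apply: (@fin_gen_surj _ _ _ (ext_cls phi M n \o k)) kerfg => xi.
have [u cu] := ext_class_surj xi.
have u0 x : u (pr_d (free_resolution M) n x) = 0.
  by have := congr1 (fun u : dual phi _ => u x) (ext_class_cocycle cu).
have /eqP a0 : dP (dual_map phi al u) = 0.
  by apply: linear_ext => x; exact: (cocycle_pullback al_lift u0).
exists (Sub (dual_map phi al u) a0 : kernel dP) => /=.
have ck y : ext_class (f y) (ext_cls phi M n (k y)) by exists (k y).
apply/(ext_class_eq (ck _) cu)/Ext_in_cobounds.
exact: (cobounds_roundtrip be_lift al_lift u0).
Qed.

(** The zero map and the identity of the resolution both lift the identity of the zero module, so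
    every cocycle is a coboundary. *)
Lemma Ext_trivial (M : lmodType R) n :
  trivial_mod M -> trivial_mod (Ext_obj phi M n).
Proof.
move=> M0; apply/trivial_Ext => u u0; apply/Ext_in_cobounds.
have lift0 i : chain_lift (X := free_resolution M) (Y := free_resolution M) (i := i) idfun \0.
  elim: i => [|i IHi] /=; first by move=> x; rewrite [LHS]M0 [RHS]M0.
  by exists \0; split=> // x; rewrite !linear0.
have ud x : u (pr_d (free_resolution M) n x) = 0.
  by have := congr1 (fun u : dual phi _ => u x) u0.
have := chain_lift_cocycle ud (@chain_lift_id _ _ (free_resolution M) n) (lift0 n).
by apply: cobounds_ext => x; rewrite /= linear0 subr0.
Qed.

End ExtFinite.

(** * Bijectivity of the biduality map and the duality *)

Section Duality.
Variables (R S : pzRingType) (phi : {rmorphism S -> R^c}) (psi : {rmorphism R -> S^c}).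
Hypothesis phiK : forall s : S, psi (phi s) = s.
Hypothesis psiK : forall r : R, phi (psi r) = r.
Hypotheses (R_noeth : noetherian R) (S_noeth : noetherian S).
Variable t : nat.
Hypotheses (R_idim : idim_le t R^o) (S_idim : idim_le t S^o).

Section Module.
Variable M : lmodType R.
Hypothesis M_fg : fin_gen M.
Hypothesis M_vanish : forall j, (j < t)%N -> Ext_vanishes phi M j.

(** The two cone lemmas at [k = 0]: [cob] gives injectivity and [dec] gives surjectivity. *)
Lemma biduality_bijective eta : is_biduality (M := M) phiK (t := t) eta -> bijective eta.
Proof.
move=> [h gh etaE]; have [P P_fg] := fg_resolution R_noeth M_fg.
have [al al_lift] := chain_lift_exists P (free_resolution M) idfun 0.
have idb : bijective (idfun : Ext_obj phi M (NatTrec.add t 0) -> _) by exists idfun.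
have dec :=
  cocycle_decomposition phiK psiK P_fg M_vanish R_idim S_idim (addn0 t) idb gh al_lift.
have cob :=
  transpose_coboundary phiK psiK P_fg M_vanish R_idim S_idim (addn0 t) idb gh al_lift.
have augE p : eta (aug M (al p)) = eta (pr_aug P p) by rewrite al_lift.
have eta_inj : injective eta.
  apply: raddf_inj => x; have [p <-] := pr_aug_surj P x => p0.
  have c1 := etaE (al p); rewrite augE p0 in c1.
  have c0 : ext_class 0 (0 : Ext_obj psi (Ext_obj phi M (NatTrec.add t 0)) t).
    by exists 0; rewrite ?linear0.
  have /Ext_in_cobounds/cobounds_shift[u uE] := (ext_class_eq c1 c0).1 erefl.
  have [q|b|p' ->] := cob u p.
  - by rewrite -uE subr0.
  - by rewrite /= linear0.
  exact: pr_aug_d.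
have eta_surj xi : exists x, eta x = xi.
  have [u cu] := ext_class_surj xi.
  have [x|v [p [uE _]]] := dec u.
    by have := congr1 (fun u : dual psi _ => u x) (ext_class_cocycle cu).
  exists (pr_aug P p); rewrite -augE; apply/esym/(ext_class_eq cu (etaE _)).
  apply/Ext_in_cobounds/cobounds_shift; exists v => q.
  by rewrite [LHS]/= uE addrK.
exists (fun y => projT1 (cid (eta_surj y))) => x; last by case: cid.
by apply: eta_inj; case: cid.
Qed.

(** Here the point [p] of the decomposition lies in positive degree [k.+1]. It is a cycle because
    functionals separate points of [P k], hence a boundary, so its contribution is a coboundary
    too. *)
Lemma Ext_Ext_vanishes j k : (j + k.+1)%N = t ->
  Ext_vanishes psi (Ext_obj phi M (NatTrec.add j k.+1)) j.
Proof.
move=> jkt u u0; have [P P_fg] := fg_resolution R_noeth M_fg.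
have [al al_lift] := chain_lift_exists P (free_resolution M) idfun k.+1.
have idb : bijective (idfun : Ext_obj phi M (NatTrec.add j k.+1) -> _) by exists idfun.
have va : forall i, (i < j + k.+1)%N -> Ext_vanishes phi M i by rewrite jkt.
have [h gh] := ext_lift_exists (idfun : {linear Ext_obj phi M (NatTrec.add j k.+1) -> _}) va.
have [x|v [p [uE bp]]] :=
  cocycle_decomposition phiK psiK P_fg M_vanish R_idim S_idim jkt idb gh al_lift (xi := u).
  by have := congr1 (fun u : dual psi _ => u x) u0.
have dp0 : pr_d P k p = 0.
  by apply: (ev_eq0 (phiK := phiK) psiK (P_fg k)) => b; rewrite /= [b _]bp rmorph0.
have [p' pE] := (pr_exact p).1 dp0; have [al1 al1E] := chain_lift_next al_lift.
apply/Ext_in_cobounds.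
have c1 : cobounds (fun i => resd i (Ext_obj phi M (NatTrec.add j k.+1))) j
    (fun q => v (shift_d (fun i => resd i (Ext_obj phi M (NatTrec.add j k.+1))) j q)).
  by apply/cobounds_shift; exists v.
have c2 := ext_lift_cobounds phiK (al1 p') gh.
apply: cobounds_ext (coboundsD c1 c2) => q; rewrite uE -pE -al1E.
by [].
Qed.
End Module.

Lemma Ext_duality_half :
  (forall M, fin_gen M /\ grade_eq phi M t ->
     fin_gen (Ext phi t M) /\ grade_eq psi (Ext phi t M) t) /\
  nat_iso_id (fun M => fin_gen M /\ grade_eq phi M t) (Ext phi t) (Ext psi t).
Proof.
have va (M : lmodType R) : grade_eq phi M t -> forall j, (j < t)%N -> Ext_vanishes phi M j.
  by move=> [_ gr] j jt; apply/trivial_Ext/gr.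
suff bid : nat_iso_id (fun M => fin_gen M /\ grade_eq phi M t)
    (Ext phi (NatTrec.add t 0)) (Ext psi t).
  rewrite NatTrec.addE addn0 in bid; split=> // M CM; have [Mfg gr] := CM.
  split; first exact: (@fin_gen_Ext _ _ _ _ phiK psiK M t R_noeth S_noeth Mfg).
  split=> [E0|j jt].
    (* If the double Ext vanished, the bijection [eta] would force [M = 0], against the nonvanishing
       of its Ext in degree [t]. *)
    apply: gr.1; apply: Ext_trivial => x; have [eta [eta_bij _]] := bid.
    by apply: (bij_inj (eta_bij M CM)); rewrite (E0 (eta M CM x)) (E0 (eta M CM 0)).
  have jk : (j + (t - j).-1.+1)%N = t by rewrite prednK ?subn_gt0 // subnKC // ltnW.
  have jk' : NatTrec.add j (t - j).-1.+1 = t by rewrite NatTrec.addE.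
  have := Ext_Ext_vanishes Mfg (va M gr) jk; rewrite jk' => vanish.
  exact: (trivial_Ext psi (Ext_obj phi M t) j).2 vanish.
pose eta M (CM : fin_gen M /\ grade_eq phi M t) :=
  projT1 (cid (biduality_exists phiK (va M CM.2))).
have etaP M CM : is_biduality phiK (t := t) (eta M CM) by rewrite /eta; case: cid.
exists eta; split=> [M CM|M M' CM CM' f x].
  exact: biduality_bijective CM.1 (va M CM.2) _ (etaP M CM).
exact: biduality_natural (va M CM.2) (etaP M CM) (etaP M' CM').
Qed.

End Duality.

Theorem corollary3p5 (L : pzRingType) (t : nat)
    (noeth_left : noetherian L) (noeth_right : noetherian L^c)
    (qAG_left : left_quasi_AG L) (qAG_right : right_quasi_AG L)
    (id_left : injdim_eq L^o t) (id_right : injdim_eq (L^c)^o t) :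
  (forall M : lmodType L, fin_gen M -> left_grade_eq M t ->
     lmod_iso M (Ext_right L t (Ext_left L t M))) /\
  duality (G_left t) (G_right t) (Ext_left L t) (Ext_right L t).
Proof.
have idl := injdim_idim id_left.1; have idr := injdim_idim id_right.1.
(* The second half is the first with the two sides exchanged; [to_conv2] identifies [L] with its
   double converse. *)
have [GL isoL] := @Ext_duality_half L L^c idfun (@to_conv2 L)
  (fun=> erefl) (fun=> erefl) noeth_left noeth_right t idl idr.
have [GR isoR] := @Ext_duality_half L^c L (@to_conv2 L) idfun
  (fun=> erefl) (fun=> erefl) noeth_right noeth_left t idr idl.
split; last by split.
move=> M Mfg gr; have [eta [eta_bij _]] := isoL.
by exists (eta M (conj Mfg gr)); apply: eta_bij.
Qed.
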